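(* Let $M_k$ be either $M_{E,k}$ for all $k$ (then set $C_\dagger=C_{E,\dagger}$, $\eta=\eta_E$) or $M_{V,k}$ for all $k$ (then set $C_\dagger=C_{V,\dagger}$, $\eta=\eta_V$), let $m\ge1$ be the number of smoothing steps, and let $E_k$ be the error propagation operator of the symmetric V-cycle multigrid method defined in the context. Then $$\|E_k\mathbf{w}\|_a\le\frac{C_\dagger/\eta}{C_\dagger/\eta+2m}\,\|\mathbf{w}\|_a\qquad\forall\,\mathbf{w}\in N_k,\ k\ge1,$$ where $\|\mathbf{w}\|_a=a(\mathbf{w},\mathbf{w})^{1/2}$.
   Context: Setting: $\Omega\subset\mathbb{R}^3$ bounded convex hexahedral domain with axis-parallel edges, $\alpha>0$ constant, $a(\mathbf{w},\mathbf{v})=\alpha\int_\Omega\nabla\times\mathbf{w}\cdot\nabla\times\mathbf{v}+\int_\Omega\mathbf{w}\cdot\mathbf{v}$. Meshes: $\mathcal{T}_0$ a partition of $\Omega$ into axis-parallel boxes, $\mathcal{T}_k$ the uniform refinement of $\mathcal{T}_{k-1}$ ($h_k=h_{k-1}/2$); $N_k\subset H_0(\mathbf{curl};\Omega)$ the lowest order Nédélec space on $\mathcal{T}_k$ (piecewise $(a_1+a_2x_2+a_3x_3+a_4x_2x_3,\,b_1+b_2x_3+b_3x_1+b_4x_3x_1,\,c_1+c_2x_1+c_3x_2+c_4x_1x_2)$, degrees of freedom $\lambda_e(\mathbf{v})=\frac1{|e|}\int_e\mathbf{v}\cdot\mathbf{t}_e$ on interior edges); $A_k:N_k\to N_k'$,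 $\langle A_k\mathbf{w},\mathbf{v}\rangle=a(\mathbf{w},\mathbf{v})$; $Id_k$ identity on $N_k$; $I_{k-1}^k:N_{k-1}\to N_k$ natural injection; $P_k^{k-1}:N_k\to N_{k-1}$ the Ritz projection $a(P_k^{k-1}\mathbf{w},\mathbf{v})=a(\mathbf{w},I_{k-1}^k\mathbf{v})$. Smoothers on level $k\ge1$ (with $\mathcal{T}_h=\mathcal{T}_k$, $\mathcal{T}_H=\mathcal{T}_{k-1}$, $N_h=N_k$): interior spaces $N_h^T=\{\mathbf{v}\in N_h:\mathbf{v}=0\text{ on }\Omega\setminus T\}$, $T\in\mathcal{T}_H$; for an interior coarse edge $E$, $N_h^E$ is the set of $\mathbf{v}\in N_h$ whose degrees of freedom vanish on all interior fine edges except those lying in the interior of one of the four coarse elements $T_E^i$ containing $E$, those contained in one of the four coarse faces $F_E^j$ containing $E$ but not in $\partial F_E^j$, and those contained in $E$, and which are $a$-orthogonal to $\sum_iN_h^{T_E^i}$; for an interior coarse vertex $V$, $N_h^V$ is defined likewise using the $8$ coarse elements, $12$ coarse faces and $6$ coarse edges containing $V$ (all fine edges contained in these coarse edges allowed), with $a$-orthogonality to the sum of the $8$ interior spaces. For each subspace $S$, $J_S$ is the inclusion, $J_S^t$ its transpose, $A_S$ given by $a$ on $S$. $M_{E,k}^{-1}=\eta_E\big(\sum_{T\in\mathcal{T}_H}J_TA_T^{-1}J_T^t+\sum_{E\in\mathcal{E}_H}J_EA_E^{-1}J_E^t\big)$ with $0<\eta_E\le1/12$, and $M_{V,k}^{-1}=\eta_V\big(\sum_TJ_TA_T^{-1}J_T^t+\sum_{V\in\mathcal{V}_H}J_VA_V^{-1}J_V^t\big)$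 with $0<\eta_V\le1/8$ ($\mathcal{E}_H,\mathcal{V}_H$ interior coarse edges/vertices). $R_k=Id_k-M_k^{-1}A_k$. Error propagation: $E_0=0$ and for $k\ge1$, $E_k=R_k^m(Id_k-I_{k-1}^kP_k^{k-1})R_k^m+R_k^m(I_{k-1}^kE_{k-1}P_k^{k-1})R_k^m$ (this is the error operator of the V-cycle with exact solve on level $0$, $m$ pre- and $m$ post-smoothing steps $\mathbf{z}\leftarrow\mathbf{z}+M_k^{-1}(g-A_k\mathbf{z})$, and coarse correction via $I_{k-1}^k$ and its transpose). With $P_H:N_h\to N_H$ the $a$-orthogonal projection, $C_{E,\dagger}$ (resp. $C_{V,\dagger}$) is a constant, independent of $\alpha$, $h$ and the number of elements, such that on every level each $\mathbf{w}\in(I-P_H)N_h$ can be written as $\sum_T\mathbf{w}_T+\sum_{E\in\mathcal{E}_H}\mathbf{w}_E$ with $\mathbf{w}_T\in N_h^T$, $\mathbf{w}_E\in N_h^E$ and $\sum_Ta(\mathbf{w}_T,\mathbf{w}_T)+\sum_Ea(\mathbf{w}_E,\mathbf{w}_E)\le C_{E,\dagger}a(\mathbf{w},\mathbf{w})$ (resp. with vertex spaces and $C_{V,\dagger}$); such constants exist. *)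

(* Defs.v *)
From Stdlib Require Import Reals Lra List ClassicalEpsilon ClassicalDescription.
From Coquelicot Require Import Coquelicot.
Import ListNotations.
Open Scope R_scope.

Inductive ax := A1 | A2 | A3.

Definition ax_eqb (i j : ax) : bool :=
  match i, j with A1, A1 | A2, A2 | A3, A3 => true | _, _ => false end.

Definition pt := ax -> R.
Definition vf := pt -> pt.

Definition mkpt (x1 x2 x3 : R) : pt :=
  fun i => match i with A1 => x1 | A2 => x2 | A3 => x3 end.

Definition upd (x : pt) (d : ax) (t : R) : pt :=
  fun i => if ax_eqb i d then t else x i.

(* closed axis-parallel boxes [lo,hi] (possibly degenerate: faces, edges, vertices) *)
Record box := Box { lo : pt ; hi : pt }.

Definition in_closed (B : box) (x : pt) : Prop := forall i, lo B i <= x i <= hi B i.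
Definition in_open (B : box) (x : pt) : Prop := forall i, lo B i < x i < hi B i.
Definition relint (B : box) (x : pt) : Prop :=
  forall i, (lo B i = hi B i /\ x i = lo B i) \/ (lo B i < x i < hi B i).
Definition box_sub (X Y : box) : Prop := forall x, in_closed X x -> in_closed Y x.
Definition relint_sub (X Y : box) : Prop := forall x, relint X x -> relint Y x.

Definition nondeg (B : box) : Prop := forall i, lo B i < hi B i.

Definition edge_of (T e : box) : Prop :=
  exists d, lo e d = lo T d /\ hi e d = hi T d /\
    forall i, i <> d -> lo e i = hi e i /\ (lo e i = lo T i \/ lo e i = hi T i).
Definition face_of (T F : box) : Prop :=
  exists n, lo F n = hi F n /\ (lo F n = lo T n \/ lo F n = hi T n) /\
    forall i, i <> n -> lo F i = lo T i /\ hi F i = hi T i.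
Definition vertex_of (T : box) (V : pt) : Prop := forall i, V i = lo T i \/ V i = hi T i.

Definition mid (B : box) (i : ax) : R := (lo B i + hi B i) / 2.
Definition child (B : box) (s : ax -> bool) : box :=
  Box (fun i => if s i then mid B i else lo B i) (fun i => if s i then hi B i else mid B i).
Definition sel (b1 b2 b3 : bool) : ax -> bool :=
  fun i => match i with A1 => b1 | A2 => b2 | A3 => b3 end.
Definition children (B : box) : list box :=
  map (child B)
    [sel false false false; sel false false true; sel false true false; sel false true true;
     sel true false false; sel true false true; sel true true false; sel true true true].
Definition refine (T : list box) : list box := flat_map children T.

Record setup := Setup { Om : box ; T0 : list box ; alpha : R }.

(* Omega a nondegenerate box; T0 a conforming partition of Omega into boxes *)
Definition valid_setup (St : setup) : Prop :=
  nondeg (Om St) /\ NoDup (T0 St) /\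
  (forall B, In B (T0 St) -> nondeg B /\ box_sub B (Om St)) /\
  (forall B B', In B (T0 St) -> In B' (T0 St) -> B <> B' ->
      forall x, ~ (in_open B x /\ in_open B' x)) /\
  (forall x, in_closed (Om St) x -> exists B, In B (T0 St) /\ in_closed B x) /\
  (forall B B', In B (T0 St) -> In B' (T0 St) ->
      (exists i, hi B i < lo B' i \/ hi B' i < lo B i) \/
      (forall i, (lo B i = lo B' i /\ hi B i = hi B' i) \/ hi B i = lo B' i \/ hi B' i = lo B i)).

Definition mesh (St : setup) (k : nat) : list box := Nat.iter k refine (T0 St).

Definition on_boundary (St : setup) (X : box) : Prop :=
  exists i, lo X i = hi X i /\ (lo X i = lo (Om St) i \/ lo X i = hi (Om St) i).

Definition is_ned_poly (p : vf) : Prop :=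
  exists a1 a2 a3 a4 b1 b2 b3 b4 c1 c2 c3 c4 : R, forall x,
    p x A1 = a1 + a2 * x A2 + a3 * x A3 + a4 * x A2 * x A3 /\
    p x A2 = b1 + b2 * x A3 + b3 * x A1 + b4 * x A3 * x A1 /\
    p x A3 = c1 + c2 * x A1 + c3 * x A2 + c4 * x A1 * x A2.

Definition piece_of (v : vf) (B : box) (p : vf) : Prop :=
  is_ned_poly p /\ forall x, in_open B x -> forall i, v x i = p x i.

(* N_k : piecewise Nedelec polynomials on mesh k with continuous tangential
   components across interior faces and vanishing tangential components on the
   boundary of Omega (= membership in H_0(curl)); the representative is
   normalised to be 0 off the open elements (a null set in Omega). *)
Definition in_N (St : setup) (k : nat) (v : vf) : Prop :=
  (forall B, In B (mesh St k) -> exists p, piece_of v B p) /\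
  (forall x, (forall B, In B (mesh St k) -> ~ in_open B x) -> forall i, v x i = 0) /\
  (forall B B' p p' n x, In B (mesh St k) -> In B' (mesh St k) ->
     piece_of v B p -> piece_of v B' p' ->
     hi B n = x n -> lo B' n = x n ->
     (forall j, j <> n -> lo B j < x j < hi B j /\ lo B' j < x j < hi B' j) ->
     forall j, j <> n -> p x j = p' x j) /\
  (forall B p n x, In B (mesh St k) -> piece_of v B p -> in_closed B x ->
     (x n = lo (Om St) n \/ x n = hi (Om St) n) ->
     (forall j, j <> n -> lo B j < x j < hi B j) ->
     forall j, j <> n -> p x j = 0).

(* lambda_e(v) = 0 for an edge e of mesh k (computed from the polynomial piece of
   any element having e as an edge; the factor 1/|e| is irrelevant for vanishing) *)
Definition dof_zero (St : setup) (k : nat) (v : vf) (e : box) : Prop :=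
  forall d B p, In B (mesh St k) -> edge_of B e -> lo e d < hi e d -> piece_of v B p ->
    RInt (fun t => p (upd (lo e) d t) d) (lo e d) (hi e d) = 0.

Definition interior_edge (St : setup) (k : nat) (e : box) : Prop :=
  (exists B, In B (mesh St k) /\ edge_of B e) /\ ~ on_boundary St e.

Definition dot (u w : pt) : R := u A1 * w A1 + u A2 * w A2 + u A3 * w A3.
Definition pd (f : vf) (i j : ax) (x : pt) : R := Derive (fun t => f (upd x j t) i) (x j).
Definition curl (f : vf) (x : pt) : pt :=
  fun i => match i with
  | A1 => pd f A3 A2 x - pd f A2 A3 x
  | A2 => pd f A1 A3 x - pd f A3 A1 x
  | A3 => pd f A2 A1 x - pd f A1 A2 x end.
Definition RInt3 (B : box) (f : pt -> R) : R :=
  RInt (fun x1 => RInt (fun x2 => RInt (fun x3 => f (mkpt x1 x2 x3))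
     (lo B A3) (hi B A3)) (lo B A2) (hi B A2)) (lo B A1) (hi B A1).

Definition a (St : setup) (w v : vf) : R :=
  RInt3 (Om St) (fun x => alpha St * dot (curl w x) (curl v x) + dot (w x) (v x)).
Definition anorm (St : setup) (v : vf) : R := sqrt (a St v v).

Definition vzero : vf := fun _ _ => 0.
Definition vadd (u v : vf) : vf := fun x i => u x i + v x i.
Definition vsub (u v : vf) : vf := fun x i => u x i - v x i.
Definition vscale (c : R) (u : vf) : vf := fun x i => c * u x i.
Definition vsum (l : list vf) : vf := fold_right vadd vzero l.
Definition rsum (l : list R) : R := fold_right Rplus 0 l.

Definition vf_inh : inhabited vf := inhabits vzero.
Definition list_inh {A} : inhabited (list A) := inhabits nil.

Definition coarse (St : setup) (k : nat) : list box := mesh St (pred k).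

Definition NT (St : setup) (k : nat) (T : box) (v : vf) : Prop :=
  in_N St k v /\ forall x, in_closed (Om St) x -> ~ in_closed T x -> forall i, v x i = 0.

Definition allowed (St : setup) (k : nat) (X e : box) : Prop :=
  exists T Y, In T (coarse St k) /\ box_sub X T /\
    (Y = T \/ face_of T Y \/ edge_of T Y) /\ box_sub X Y /\ relint_sub e Y.

(* N_h^E (X a coarse edge) and N_h^V (X = [V,V] a coarse vertex) *)
Definition NX (St : setup) (k : nat) (X : box) (v : vf) : Prop :=
  in_N St k v /\
  (forall e, interior_edge St k e -> ~ allowed St k X e -> dof_zero St k v e) /\
  (forall T u, In T (coarse St k) -> box_sub X T -> NT St k T u -> a St v u = 0).

Inductive smoother := EdgeS | VertexS.

Definition patch_pred (St : setup) (s : smoother) (k : nat) (X : box) : Prop :=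
  match s with
  | EdgeS => (exists T, In T (coarse St k) /\ edge_of T X) /\ ~ on_boundary St X
  | VertexS => (exists T V, In T (coarse St k) /\ vertex_of T V /\ X = Box V V)
               /\ ~ on_boundary St X
  end.

Definition patches (St : setup) (s : smoother) (k : nat) : list box :=
  epsilon list_inh (fun l => NoDup l /\ forall X, In X l <-> patch_pred St s k X).

Definition eta_max (s : smoother) : R :=
  match s with EdgeS => 1/12 | VertexS => 1/8 end.

(* J_Sub A_Sub^{-1} J_Sub^t g, for a functional g *)
Definition Ainv (St : setup) (Sub : vf -> Prop) (g : vf -> R) : vf :=
  epsilon vf_inh (fun z => Sub z /\ forall v, Sub v -> a St z v = g v).

Definition Minv (St : setup) (s : smoother) (eta : R) (k : nat) (g : vf -> R) : vf :=
  vscale eta (vadd (vsum (map (fun T => Ainv St (NT St k T) g) (coarse St k)))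
                   (vsum (map (fun X => Ainv St (NX St k X) g) (patches St s k)))).

Definition Rop (St : setup) (s : smoother) (eta : R) (k : nat) (w : vf) : vf :=
  vsub w (Minv St s eta k (fun v => a St w v)).
Definition Rm (St : setup) (s : smoother) (eta : R) (m k : nat) (w : vf) : vf :=
  Nat.iter m (Rop St s eta k) w.

(* I_{k-1}^k : natural injection (representative renormalised on mesh k) *)
Definition inj (St : setup) (k : nat) (v : vf) : vf :=
  fun x => if excluded_middle_informative (exists B, In B (mesh St k) /\ in_open B x)
           then v x else vzero x.

Definition Pproj (St : setup) (k : nat) (w : vf) : vf :=
  epsilon vf_inh (fun z => in_N St (pred k) z /\
     forall v, in_N St (pred k) v -> a St z v = a St w (inj St k v)).

Fixpoint Eop (St : setup) (s : smoother) (eta : R) (m k : nat) : vf -> vf :=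
  match k with
  | O => fun _ => vzero
  | S k' => fun w =>
      let r := Rm St s eta m (S k') w in
      vadd (Rm St s eta m (S k') (vsub r (inj St (S k') (Pproj St (S k') r))))
           (Rm St s eta m (S k') (inj St (S k') (Eop St s eta m k' (Pproj St (S k') r))))
  end.

Definition decomposition_constant (St : setup) (s : smoother) (C : R) : Prop :=
  forall k u, (1 <= k)%nat -> in_N St k u ->
    let w := vsub u (inj St k (Pproj St k u)) in
    exists (wT wX : box -> vf),
      (forall T, In T (coarse St k) -> NT St k T (wT T)) /\
      (forall X, In X (patches St s k) -> NX St k X (wX X)) /\
      (forall x i, w x i = vadd (vsum (map wT (coarse St k))) (vsum (map wX (patches St s k))) x i) /\
      rsum (map (fun T => a St (wT T) (wT T)) (coarse St k)) +
      rsum (map (fun X => a St (wX X) (wX X)) (patches St s k)) <= C * a St w w.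

(* Main.v *)
(* Every level carries the Schwarz operator B = M_k^-1 A_k = eta * sum_i P_i, a multiple of a sum
   of a-orthogonal projections, and R = I - B. Interior spaces are orthogonal to each other and
   to the patch spaces, and a patch function vanishes on the coarse elements not containing the
   patch centre, so at almost every point at most 12 (edges) or 8 (vertices) patch functions
   overlap; hence 0 <= R <= I for the form a. The stable decomposition, paired termwise with the
   P_i, gives, for the coarse projection Q, a((I - Q)v, v) <= K a((I - R)v, v) with K = C / eta,
   while a((I - R) R^m w, R^m w) <= (a(w, w) - a(R^m w, R^m w)) / (2m). Put
   gamma = K / (K + 2m), so that (1 - gamma) K = 2m gamma; then 0 <= E_(k-1) <= gamma yields
     a(E_k w, w) <= (1 - gamma) a((I - Q)v, v) + gamma a(v, v) <= gamma a(w, w),  v = R^m w,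
   and Cauchy-Schwarz for the form a(E_k u, v) turns this into the norm bound. Definiteness of a
   is never needed. *)
From Stdlib Require Import Reals Lra Lia List FinFun ClassicalEpsilon ClassicalDescription FunctionalExtensionality.
From Coquelicot Require Import Coquelicot.
Require Import Defs.
Import ListNotations.
Open Scope R_scope.

(** * Iterated integrals *)

(** Two obstacles shape the development. First, [a] is an iterated total [RInt] of total [Derive]s,
    so even its bilinearity has to be earned: integrability goes through element indicators times
    polynomials, with the values on the mesh planes disregarded. Second, all projections and local
    solves are choices by [epsilon]. A solution is shown to exist by means of finitely many
    separating functionals, without bases or matrices, and the chosen one is known only through its
    values of [a] against test functions. The chosen operators are therefore never treated as linear
    maps; where linearity would be used, symmetry moves the operator to the other argument, in which
    the form is linear. Counting overlap pointwise on the energy density, rather than by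
    Cauchy-Schwarz between patches, gives exactly 12 and 8, the reciprocals of the largest allowed
    eta. *)

Lemma is_RInt_ext_off (f g : R -> R) (L : list R) (c d v : R) :
  c <= d -> (forall x, c < x < d -> ~ In x L -> f x = g x) ->
  is_RInt f c d v -> is_RInt g c d v.
Proof.
  revert c d v; induction L as [|y L IH]; intros c d v Hcd H Hf.
  - apply is_RInt_ext with f; [|exact Hf].
    intros x; rewrite Rmin_left, Rmax_right by lra; auto.
  (* An exceptional point inside the interval is made an endpoint of two subintervals, where values
     do not matter. *)
  - destruct (excluded_middle_informative (c < y < d)) as [Hy|Hy].
    + assert (E1 : ex_RInt f c y) by (apply @ex_RInt_Chasles_1 with d; [lra | now exists v]).
      assert (E2 : ex_RInt f y d) by (apply @ex_RInt_Chasles_2 with c; [lra | now exists v]).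
      destruct E1 as [v1 E1], E2 as [v2 E2].
      assert (Ev : v = plus v1 v2).
      { rewrite <- (is_RInt_unique _ _ _ _ Hf).
        apply is_RInt_unique, is_RInt_Chasles with y; assumption. }
      rewrite Ev; apply is_RInt_Chasles with y.
      * apply IH; [lra| |exact E1].
        intros x Hx Hn; apply H; [lra|]; intros [<-|Hi]; [lra|auto].
      * apply IH; [lra| |exact E2].
        intros x Hx Hn; apply H; [lra|]; intros [<-|Hi]; [lra|auto].
    + apply IH; auto.
      intros x Hx Hn; apply H; [lra|]; intros [<-|Hi]; auto.
Qed.

Lemma is_RInt_lin (f g : R -> R) (c d k v w : R) :
  is_RInt f c d v -> is_RInt g c d w ->
  is_RInt (fun x => f x + k * g x) c d (v + k * w).
Proof.
  intros Hf Hg.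
  exact (is_RInt_plus f _ c d v _ Hf (is_RInt_scal g c d k w Hg)).
Qed.

Lemma is_RInt_ge_0_off (f : R -> R) (L : list R) (c d v : R) :
  c <= d -> (forall x, c < x < d -> ~ In x L -> 0 <= f x) ->
  is_RInt f c d v -> 0 <= v.
Proof.
  intros Hcd H Hf.
  pose (g := fun x => if excluded_middle_informative (In x L) then 0 else f x).
  assert (Hg : is_RInt g c d v).
  { apply is_RInt_ext_off with f L; auto.
    intros x _ Hx; unfold g; destruct excluded_middle_informative; tauto. }
  rewrite <- (is_RInt_unique _ _ _ _ Hg).
  apply RInt_ge_0; [exact Hcd | now exists v |].
  intros x Hx; unfold g; destruct excluded_middle_informative; [lra | auto].
Qed.

Definition generic (B : box) (L : list R) (x : pt) : Prop :=
  in_open B x /\ forall i, ~ In (x i) L.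

(* Iterated Riemann integrability where, at each stage, finitely many values of the
   outer variables may be disregarded: the integrands of [a] are arbitrary on the
   coordinate planes carrying the mesh faces. *)
Definition is_RInt3 (B : box) (f : pt -> R) (v : R) : Prop :=
  exists (L : list R) (F2 : R -> R -> R) (F1 : R -> R),
    (forall x1 x2, lo B A1 < x1 < hi B A1 -> ~ In x1 L ->
       lo B A2 < x2 < hi B A2 -> ~ In x2 L ->
       is_RInt (fun x3 => f (mkpt x1 x2 x3)) (lo B A3) (hi B A3) (F2 x1 x2)) /\
    (forall x1, lo B A1 < x1 < hi B A1 -> ~ In x1 L ->
       is_RInt (F2 x1) (lo B A2) (hi B A2) (F1 x1)) /\
    is_RInt F1 (lo B A1) (hi B A1) v.

Section Integral3.

Variable B : box.
Hypothesis HB : nondeg B.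

Let B1 : lo B A1 <= hi B A1. Proof. apply Rlt_le, HB. Qed.
Let B2 : lo B A2 <= hi B A2. Proof. apply Rlt_le, HB. Qed.
Let B3 : lo B A3 <= hi B A3. Proof. apply Rlt_le, HB. Qed.

Lemma generic_mkpt L x1 x2 x3 :
  lo B A1 < x1 < hi B A1 -> ~ In x1 L -> lo B A2 < x2 < hi B A2 -> ~ In x2 L ->
  lo B A3 < x3 < hi B A3 -> ~ In x3 L -> generic B L (mkpt x1 x2 x3).
Proof. intros; split; intros []; assumption. Qed.

(** At exceptional outer values the inner [RInt] may be a meaningless default, but finitely many
    such values do not affect the next integral. *)
Lemma is_RInt3_unique f v : is_RInt3 B f v -> RInt3 B f = v.
Proof.
  intros (L & F2 & F1 & H2 & H1 & H0); unfold RInt3.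
  apply is_RInt_unique, (is_RInt_ext_off F1 _ L); auto.
  intros x1 K1 N1; symmetry; apply is_RInt_unique.
  apply (is_RInt_ext_off (F2 x1) _ L); auto.
  intros x2 K2 N2; symmetry; apply is_RInt_unique; auto.
Qed.

Lemma is_RInt3_ext f g L v :
  (forall x, generic B L x -> f x = g x) -> is_RInt3 B f v -> is_RInt3 B g v.
Proof.
  intros Hfg (L' & F2 & F1 & H2 & H1 & H0).
  exists (L ++ L'), F2, F1; repeat split; auto.
  - intros x1 x2 K1 N1 K2 N2; rewrite in_app_iff in *.
    apply (is_RInt_ext_off (fun x3 => f (mkpt x1 x2 x3)) _ L); auto.
    intros x3 K3 N3; apply Hfg, generic_mkpt; tauto.
  - intros x1 K1 N1; rewrite in_app_iff in *; auto.
Qed.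

Lemma is_RInt3_lin f g c v w :
  is_RInt3 B f v -> is_RInt3 B g w -> is_RInt3 B (fun x => f x + c * g x) (v + c * w).
Proof.
  intros (L & F2 & F1 & H2 & H1 & H0) (L' & G2 & G1 & K2 & K1 & K0).
  exists (L ++ L'), (fun x1 x2 => F2 x1 x2 + c * G2 x1 x2), (fun x1 => F1 x1 + c * G1 x1).
  repeat split.
  - intros x1 x2 J1 N1 J2 N2; rewrite in_app_iff in *.
    apply (is_RInt_lin (fun x3 => f (mkpt x1 x2 x3)) (fun x3 => g (mkpt x1 x2 x3))); auto.
  - intros x1 J1 N1; rewrite in_app_iff in *; apply is_RInt_lin; auto.
  - apply is_RInt_lin; auto.
Qed.

Lemma is_RInt3_zero : is_RInt3 B (fun _ => 0) 0.
Proof.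
  assert (Z : forall c d, is_RInt (fun _ : R => 0) c d 0).
  { intros c d; pose proof (is_RInt_const (V := R_NormedModule) c d 0) as H.
    unfold scal in H; simpl in H; unfold mult in H; simpl in H.
    rewrite Rmult_0_r in H; exact H. }
  exists nil, (fun _ _ => 0), (fun _ => 0); auto.
Qed.

Lemma is_RInt3_ge_0 f L v :
  (forall x, generic B L x -> 0 <= f x) -> is_RInt3 B f v -> 0 <= v.
Proof.
  intros Hf (L' & F2 & F1 & H2 & H1 & H0).
  apply (is_RInt_ge_0_off F1 (L ++ L') _ _ _ B1); [|exact H0].
  intros x1 K1 N1; rewrite in_app_iff in N1.
  apply (is_RInt_ge_0_off (F2 x1) (L ++ L') _ _ _ B2); [|auto].
  intros x2 K2 N2; rewrite in_app_iff in N2.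
  apply (is_RInt_ge_0_off (fun x3 => f (mkpt x1 x2 x3)) L _ _ _ B3); [|auto].
  intros x3 K3 N3; apply Hf, generic_mkpt; tauto.
Qed.

Definition integrable3 (f : pt -> R) : Prop := exists v, is_RInt3 B f v.

Lemma RInt3_correct f : integrable3 f -> is_RInt3 B f (RInt3 B f).
Proof. intros [v Hv]; rewrite (is_RInt3_unique f v Hv); exact Hv. Qed.

(** * Integrability of polynomials on sub-boxes *)

Definition ind1 (c d x : R) : R :=
  if excluded_middle_informative (c < x < d) then 1 else 0.

Lemma ex_RInt_ind1 (g : R -> R) (c d c' d' : R) :
  c' <= c -> c <= d -> d <= d' -> (forall x, continuous g x) ->
  exists v, is_RInt (fun x => ind1 c d x * g x) c' d' v.
Proof.
  intros H1 H2 H3 Hg.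
  assert (Z : forall u v, (v <= c \/ d <= u) -> u <= v ->
    ex_RInt (fun x => ind1 c d x * g x) u v).
  { intros u v Huv Hle; apply ex_RInt_ext with (fun _ => 0); [|apply ex_RInt_const].
    intros x; rewrite Rmin_left, Rmax_right by lra; intros Hx; unfold ind1.
    destruct excluded_middle_informative; [lra | symmetry; apply Rmult_0_l]. }
  apply ex_RInt_Chasles with c; [apply Z; lra|].
  apply ex_RInt_Chasles with d; [|apply Z; lra].
  apply ex_RInt_ext with g; [|apply @ex_RInt_continuous; auto].
  intros x; rewrite Rmin_left, Rmax_right by lra; intros Hx; unfold ind1.
  destruct excluded_middle_informative; [symmetry; apply Rmult_1_l | lra].
Qed.

(** Presented by generators, so that integrability follows by induction from monomials, whose
    product with a box indicator separates into three one-variable factors. *)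
Inductive Pol : (pt -> R) -> Prop :=
| Pol_mono i j k : Pol (fun x => x A1 ^ i * x A2 ^ j * x A3 ^ k)
| Pol_lin f g c : Pol f -> Pol g -> Pol (fun x => f x + c * g x).

Lemma Pol_ext f g : (forall x, f x = g x) -> Pol f -> Pol g.
Proof. intros H; replace g with f by (extensionality x; auto); auto. Qed.

Lemma Pol_zero : Pol (fun _ => 0).
Proof.
  apply (Pol_ext (fun x => x A1 ^ 0 * x A2 ^ 0 * x A3 ^ 0 + (-1) * (x A1 ^ 0 * x A2 ^ 0 * x A3 ^ 0))).
  - intros; ring.
  - apply Pol_lin; apply Pol_mono.
Qed.

Lemma Pol_add f g : Pol f -> Pol g -> Pol (fun x => f x + g x).
Proof.
  intros Hf Hg; apply (Pol_ext (fun x => f x + 1 * g x)); [intros; ring|].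
  now apply Pol_lin.
Qed.

Lemma Pol_scal c f : Pol f -> Pol (fun x => c * f x).
Proof.
  intros Hf; apply (Pol_ext (fun x => 0 + c * f x)); [intros; ring|].
  now apply Pol_lin; [apply Pol_zero|].
Qed.

Lemma Pol_mult f g : Pol f -> Pol g -> Pol (fun x => f x * g x).
Proof.
  intros Hf Hg; induction Hf as [i j k|f1 f2 c H1 IH1 H2 IH2].
  - induction Hg as [i' j' k'|g1 g2 c H1 IH1 H2 IH2].
    + apply (Pol_ext (fun x => x A1 ^ (i + i') * x A2 ^ (j + j') * x A3 ^ (k + k'))).
      * intros x; rewrite !pow_add; ring.
      * apply Pol_mono.
    + eapply Pol_ext; [|exact (Pol_lin _ _ c IH1 IH2)]; intros x; simpl; ring.
  - eapply Pol_ext; [|exact (Pol_lin _ _ c IH1 IH2)]; intros x; simpl; ring.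
Qed.

Lemma Pol_const c : Pol (fun _ => c).
Proof.
  apply (Pol_ext (fun x => c * (x A1 ^ 0 * x A2 ^ 0 * x A3 ^ 0))); [intros; simpl; ring|].
  apply Pol_scal, Pol_mono.
Qed.

Lemma Pol_coord i : Pol (fun x => x i).
Proof.
  destruct i.
  - apply (Pol_ext (fun x => x A1 ^ 1 * x A2 ^ 0 * x A3 ^ 0)); [intros; simpl; ring|apply Pol_mono].
  - apply (Pol_ext (fun x => x A1 ^ 0 * x A2 ^ 1 * x A3 ^ 0)); [intros; simpl; ring|apply Pol_mono].
  - apply (Pol_ext (fun x => x A1 ^ 0 * x A2 ^ 0 * x A3 ^ 1)); [intros; simpl; ring|apply Pol_mono].
Qed.

Definition ind (C : box) (x : pt) : R :=
  if excluded_middle_informative (in_open C x) then 1 else 0.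

Lemma ind_mkpt C x1 x2 x3 :
  ind C (mkpt x1 x2 x3) =
  ind1 (lo C A1) (hi C A1) x1 * ind1 (lo C A2) (hi C A2) x2 * ind1 (lo C A3) (hi C A3) x3.
Proof.
  unfold ind, ind1.
  destruct (excluded_middle_informative (in_open C (mkpt x1 x2 x3))) as [H|H];
  destruct (excluded_middle_informative (lo C A1 < x1 < hi C A1)) as [G1|G1];
  destruct (excluded_middle_informative (lo C A2 < x2 < hi C A2)) as [G2|G2];
  destruct (excluded_middle_informative (lo C A3 < x3 < hi C A3)) as [G3|G3]; try ring;
  exfalso; try (apply H; intros []; assumption); 
  pose proof (H A1); pose proof (H A2); pose proof (H A3); simpl in *; tauto.
Qed.

Lemma integrable3_ind_Pol C f :
  nondeg C -> (forall i, lo B i <= lo C i /\ hi C i <= hi B i) -> Pol f ->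
  integrable3 (fun x => ind C x * f x).
Proof.
  intros HC Hsub Hf; induction Hf as [i j k|f g c Hf [v Hv] Hg [w Hw]].
  - assert (X : forall d n, exists v,
      is_RInt (fun x => ind1 (lo C d) (hi C d) x * x ^ n) (lo B d) (hi B d) v).
    { intros d n; apply ex_RInt_ind1; [apply Hsub | apply Rlt_le, HC | apply Hsub |].
      intros x; apply (ex_derive_continuous (fun y : R => y ^ n)); auto_derive; auto. }
    destruct (X A1 i) as [v1 E1], (X A2 j) as [v2 E2], (X A3 k) as [v3 E3].
    pose (f1 := fun x => ind1 (lo C A1) (hi C A1) x * x ^ i).
    pose (f2 := fun x => ind1 (lo C A2) (hi C A2) x * x ^ j).
    (* Each stage of the iteration replaces one more factor, x3 first, by its integral; no outer
       value is exceptional. *)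
    exists (v3 * v2 * v1), nil, (fun x1 x2 => f1 x1 * f2 x2 * v3), (fun x1 => v3 * f1 x1 * v2).
    repeat split.
    + intros x1 x2 _ _ _ _.
      eapply is_RInt_ext; [|exact (is_RInt_scal _ _ _ (f1 x1 * f2 x2) _ E3)].
      intros x3 _; rewrite ind_mkpt; unfold f1, f2, scal; simpl; unfold mult; simpl; ring.
    + intros x1 _ _.
      eapply is_RInt_ext; [|exact (is_RInt_scal _ _ _ (v3 * f1 x1) _ E2)].
      intros x3 _; unfold f2, scal; simpl; unfold mult; simpl; ring.
    + eapply is_RInt_ext; [|exact (is_RInt_scal _ _ _ (v3 * v2) _ E1)].
      intros x3 _; unfold f1, scal; simpl; unfold mult; simpl; ring.
  - exists (v + c * w).
    apply (is_RInt3_ext (fun x => ind C x * f x + c * (ind C x * g x)) _ nil);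
      [intros; ring | now apply is_RInt3_lin].
Qed.

End Integral3.

(** * Mesh geometry *)

Lemma box_ext B B' : (forall i, lo B i = lo B' i) -> (forall i, hi B i = hi B' i) -> B = B'.
Proof.
  destruct B as [l h], B' as [l' h']; simpl; intros H H'.
  f_equal; extensionality i; auto.
Qed.

Definition within (X Y : box) : Prop := forall i, lo Y i <= lo X i /\ hi X i <= hi Y i.

Lemma box_sub_within X Y : (forall i, lo X i <= hi X i) -> box_sub X Y -> within X Y.
Proof.
  intros HX H i; split.
  - apply (H (lo X)); intros j; specialize (HX j); lra.
  - apply (H (hi X)); intros j; specialize (HX j); lra.
Qed.

Lemma within_box_sub X Y : within X Y -> box_sub X Y.
Proof. intros H x Hx i; specialize (H i); specialize (Hx i); lra. Qed.

Definition separated (B B' : box) : Prop := exists i, hi B i < lo B' i \/ hi B' i < lo B i.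
Definition aligned_at (B B' : box) (i : ax) : Prop :=
  (lo B i = lo B' i /\ hi B i = hi B' i) \/ hi B i = lo B' i \/ hi B' i = lo B i.

(** The invariant carried through refinement. Disjointness of the open elements follows from
    [gm_conf]: aligned intervals with overlapping interiors coincide. *)
Record good_mesh (O : box) (l : list box) : Prop := {
  gm_nondeg : forall B, In B l -> nondeg B;
  gm_within : forall B, In B l -> within B O;
  gm_nodup : NoDup l;
  gm_conf : forall B B', In B l -> In B' l ->
    separated B B' \/ forall i, aligned_at B B' i;
  gm_cover : forall x, in_closed O x -> exists B, In B l /\ in_closed B x }.

Lemma gm_aligned O l B B' x : good_mesh O l -> In B l -> In B' l ->
  in_closed B x -> in_closed B' x -> forall i, aligned_at B B' i.
Proof.
  intros G H H' Hx Hx'; destruct (gm_conf _ _ G B B' H H') as [[i Hi]|Ha]; auto.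
  specialize (Hx i); specialize (Hx' i); lra.
Qed.

Lemma open_closed B x : in_open B x -> in_closed B x.
Proof. intros H i; specialize (H i); lra. Qed.

Lemma gm_disjoint O l B B' x : good_mesh O l -> In B l -> In B' l ->
  in_open B x -> in_open B' x -> B = B'.
Proof.
  intros G H H' Hx Hx'.
  pose proof (gm_aligned _ _ _ _ x G H H' (open_closed _ _ Hx) (open_closed _ _ Hx')) as Ha.
  apply box_ext; intros i; specialize (Ha i); specialize (Hx i); specialize (Hx' i);
    unfold aligned_at in Ha; lra.
Qed.

Lemma child_within T s : nondeg T -> within (child T s) T.
Proof.
  intros H i; specialize (H i); simpl; unfold mid; destruct (s i); lra.
Qed.

Lemma child_nondeg T s : nondeg T -> nondeg (child T s).
Proof. intros H i; specialize (H i); simpl; unfold mid; destruct (s i); lra. Qed.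

Lemma within_open X Y x : within X Y -> in_open X x -> in_open Y x.
Proof. intros H Hx i; specialize (H i); specialize (Hx i); lra. Qed.

Lemma within_closed X Y x : within X Y -> in_closed X x -> in_closed Y x.
Proof. intros H Hx i; specialize (H i); specialize (Hx i); lra. Qed.

Lemma mid_open B : nondeg B -> in_open B (mid B).
Proof. intros H i; specialize (H i); unfold mid; lra. Qed.

Lemma in_children T C : In C (children T) <-> exists s, C = child T s.
Proof.
  unfold children; rewrite in_map_iff; split.
  - intros [s [<- _]]; now exists s.
  - intros [s ->]; exists (sel (s A1) (s A2) (s A3)); split.
    + f_equal; extensionality i; now destruct i.
    + destruct (s A1), (s A2), (s A3); simpl; tauto.
Qed.

Lemma in_refine l C : In C (refine l) <-> exists T s, In T l /\ C = child T s.
Proof.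
  unfold refine; rewrite in_flat_map; split.
  - intros [T [HT HC]]; apply in_children in HC as [s ->]; now exists T, s.
  - intros [T [s [HT ->]]]; exists T; split; [assumption | apply in_children; now exists s].
Qed.

Lemma NoDup_children T : nondeg T -> NoDup (children T).
Proof.
  intros HT; apply FinFun.Injective_map_NoDup.
  - intros s s' E; extensionality i.
    assert (Hl : lo (child T s) i = lo (child T s') i) by now rewrite E.
    specialize (HT i); simpl in Hl; unfold mid in Hl.
    destruct (s i), (s' i); auto; lra.
  - assert (N : forall (f g : ax -> bool), (f A1, f A2, f A3) <> (g A1, g A2, g A3) -> f <> g)
      by (intros f g H ->; auto).
    repeat constructor; simpl; intros H;
    repeat (destruct H as [H|H]; [revert H; apply N; simpl; congruence|]); exact H.
Qed.

Lemma good_mesh_refine O l : good_mesh O l -> good_mesh O (refine l).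
Proof.
  intros G; split.
  - intros B HB; apply in_refine in HB as (T & s & HT & ->).
    apply child_nondeg, (gm_nondeg _ _ G _ HT).
  - intros B HB; apply in_refine in HB as (T & s & HT & ->); intros i.
    pose proof (child_within T s (gm_nondeg _ _ G _ HT) i).
    pose proof (gm_within _ _ G _ HT i); lra.
  - assert (K : forall l', incl l' l -> NoDup l' -> NoDup (refine l')).
    { induction l' as [|T l' IH]; intros Hi Hn; [constructor|].
      inversion Hn; subst; apply NoDup_app.
      - apply NoDup_children, (gm_nondeg _ _ G), Hi; now left.
      - apply IH; auto; intros z Hz; apply Hi; now right.
      - intros C HC HC'; apply in_children in HC as [s ->].
        apply in_refine in HC' as (T' & s' & HT' & E).
        assert (IT : In T l) by (apply Hi; now left).
        assert (IT' : In T' l) by (apply Hi; now right).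
        pose proof (gm_nondeg _ _ G _ IT) as N; pose proof (gm_nondeg _ _ G _ IT') as N'.
        assert (T = T') as ->; [|contradiction].
        (* The midpoint of a common child would lie in the interior of both parents. *)
        apply (gm_disjoint O l _ _ (mid (child T s))); auto.
        + apply (within_open (child T s)); [now apply child_within|].
          now apply mid_open, child_nondeg.
        + rewrite E; apply (within_open (child T' s')); [now apply child_within|].
          now apply mid_open, child_nondeg. }
    apply K; [intros z; auto | apply (gm_nodup _ _ G)].
  - intros B B' HB HB'.
    apply in_refine in HB as (T & s & HT & ->); apply in_refine in HB' as (T' & s' & HT' & ->).
    pose proof (gm_nondeg _ _ G _ HT) as N; pose proof (gm_nondeg _ _ G _ HT') as N'.
    (* Halves of aligned intervals coincide, touch or leave a gap, and a gap on one axis already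
       separates the children. *)
    destruct (excluded_middle_informative (separated (child T s) (child T' s'))) as [S|S]; auto.
    right; intros i.
    assert (Si : ~ (hi (child T s) i < lo (child T' s') i \/ hi (child T' s') i < lo (child T s) i))
      by (intros Hi; apply S; now exists i).
    destruct (gm_conf _ _ G T T' HT HT') as [[j Hj]|Ha].
    + exfalso; apply S; exists j.
      pose proof (child_within T s N j); pose proof (child_within T' s' N' j); lra.
    + specialize (Ha i); specialize (N i); specialize (N' i); unfold aligned_at in *.
      revert Si; simpl; unfold mid; destruct (s i), (s' i); lra.
  - intros x Hx; destruct (gm_cover _ _ G x Hx) as (T & HT & Hx').
    pose (s := fun i => if Rle_dec (x i) (mid T i) then false else true).
    exists (child T s); split; [apply in_refine; now exists T, s|].
    intros i; specialize (Hx' i); simpl; unfold s; destruct Rle_dec; lra.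
Qed.

Lemma good_mesh_level St k : valid_setup St -> good_mesh (Om St) (mesh St k).
Proof.
  intros (H1 & H2 & H3 & H4 & H5 & H6); induction k as [|k IH].
  - split; auto.
    + intros B HB; now apply H3.
    + intros B HB; destruct (H3 B HB) as [N S]; apply box_sub_within; auto.
      intros i; specialize (N i); lra.
  - now apply good_mesh_refine.
Qed.

Lemma mesh_parent St k B : valid_setup St -> In B (mesh St (S k)) ->
  exists T, In T (mesh St k) /\ within B T.
Proof.
  intros V HB; apply in_refine in HB as (T & s & HT & ->); exists T; split; auto.
  apply child_within, (gm_nondeg _ _ (good_mesh_level St k V) _ HT).
Qed.

(** The exceptional values fed to [generic]: a point avoiding them lies on no plane that carries a
    mesh face. *)
Definition coords (l : list box) : list R :=
  flat_map (fun B => [lo B A1; lo B A2; lo B A3; hi B A1; hi B A2; hi B A3]) l.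

Lemma generic_in_open O l x : good_mesh O l -> generic O (coords l) x ->
  exists B, In B l /\ in_open B x.
Proof.
  intros G [Hx Hn]; destruct (gm_cover _ _ G x (open_closed _ _ Hx)) as (B & HB & Hc).
  exists B; split; auto.
  assert (K : forall i, x i <> lo B i /\ x i <> hi B i).
  { intros i; specialize (Hn i); unfold coords in Hn.
    rewrite in_flat_map in Hn.
    split; intros E; apply Hn; exists B; rewrite E; destruct i; simpl; tauto. }
  intros i; specialize (K i); specialize (Hc i); lra.
Qed.

(** Here [d] is the direction of the edge; the value of [s] at [d] is ignored. *)
Definition edge (T : box) (d : ax) (s : ax -> bool) : box :=
  let c i := if s i then hi T i else lo T i in
  Box (fun i => if ax_eqb i d then lo T i else c i)
      (fun i => if ax_eqb i d then hi T i else c i).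

(** Four positions for each of three directions: the length 12 becomes the overlap constant of the
    edge smoother, as the length 8 of [vertex_list] does for vertices. *)
Definition edge_list (T : box) : list box :=
  flat_map (fun p : bool * bool => let (b, c) := p in
      [edge T A1 (sel false b c); edge T A2 (sel b false c); edge T A3 (sel b c false)])
    [(false, false); (false, true); (true, false); (true, true)].

Lemma edge_of_list T e : edge_of T e -> In e (edge_list T).
Proof.
  intros (d & Hl & Hh & Ho).
  assert (C : forall i, exists b : bool, i <> d ->
            lo e i = (if b then hi T i else lo T i) /\ hi e i = (if b then hi T i else lo T i)).
  { intros i; destruct (excluded_middle_informative (i = d)) as [E|E]; [exists true; tauto|].
    destruct (Ho i E) as [E1 [E2|E2]]; [exists false | exists true]; intros _; split; congruence. }
  destruct (C A1) as [b1 C1], (C A2) as [b2 C2], (C A3) as [b3 C3].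
  assert (E : forall s, (forall i, i <> d -> s i = sel b1 b2 b3 i) -> e = edge T d s).
  { intros s Hs; apply box_ext; intros i; simpl;
    destruct (excluded_middle_informative (i = d)) as [->|N].
    - destruct d; exact Hl.
    - replace (ax_eqb i d) with false by (destruct i, d; simpl; congruence).
      rewrite (Hs i N); destruct i; simpl; [apply C1 | apply C2 | apply C3]; auto.
    - destruct d; exact Hh.
    - replace (ax_eqb i d) with false by (destruct i, d; simpl; congruence).
      rewrite (Hs i N); destruct i; simpl; [apply C1 | apply C2 | apply C3]; auto. }
  destruct d.
  - rewrite (E (sel false b2 b3)) by (intros []; simpl; congruence).
    apply in_flat_map; exists (b2, b3); split; [destruct b2, b3; simpl; tauto | simpl; auto].
  - rewrite (E (sel b1 false b3)) by (intros []; simpl; congruence).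
    apply in_flat_map; exists (b1, b3); split; [destruct b1, b3; simpl; tauto | simpl; auto].
  - rewrite (E (sel b1 b2 false)) by (intros []; simpl; congruence).
    apply in_flat_map; exists (b1, b2); split; [destruct b1, b2; simpl; tauto | simpl; auto].
Qed.

Lemma edge_edge_of T d s : edge_of T (edge T d s).
Proof.
  exists d; simpl; replace (ax_eqb d d) with true by now destruct d.
  repeat split; auto; replace (ax_eqb i d) with false by (destruct i, d; simpl; congruence).
  - reflexivity.
  - destruct (s i); auto.
Qed.

Definition vertex_list (T : box) : list box :=
  map (fun s => let V i := if s i : bool then hi T i else lo T i in Box V V)
    [sel false false false; sel false false true; sel false true false; sel false true true;
     sel true false false; sel true false true; sel true true false; sel true true true].

Lemma vertex_of_list T V : vertex_of T V <-> In (Box V V) (vertex_list T).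
Proof.
  unfold vertex_list; rewrite in_map_iff; split.
  - intros H.
    assert (C : forall i, exists b : bool, V i = if b then hi T i else lo T i).
    { intros i; destruct (H i); [now exists false | now exists true]. }
    destruct (C A1) as [b1 C1], (C A2) as [b2 C2], (C A3) as [b3 C3].
    exists (sel b1 b2 b3); split.
    + apply box_ext; intros []; simpl; auto.
    + destruct b1, b2, b3; simpl; tauto.
  - intros (s & E & _) i.
    assert (Ei : lo (Box V V) i = if s i then hi T i else lo T i) by now rewrite <- E.
    simpl in Ei; destruct (s i); auto.
Qed.

Definition patch_list (s : smoother) (T : box) : list box :=
  match s with EdgeS => edge_list T | VertexS => vertex_list T end.

(** Since [patches] is a choice, some list must be exhibited: the subfaces of the coarse elements,
    filtered and freed of duplicates. *)
Lemma patches_spec St s k :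
  NoDup (patches St s k) /\ forall X, In X (patches St s k) <-> patch_pred St s k X.
Proof.
  unfold patches; apply epsilon_spec.
  assert (D : forall X Y : box, {X = Y} + {X <> Y})
    by (intros; apply excluded_middle_informative).
  exists (nodup D (filter (fun X => if excluded_middle_informative (patch_pred St s k X)
                                    then true else false)
            (flat_map (patch_list s) (coarse St k)))).
  split; [apply NoDup_nodup|]; intros X.
  rewrite nodup_In, filter_In; destruct excluded_middle_informative as [H|H];
    [|split; [intros [_ K]; discriminate | contradiction]].
  split; auto; intros _; split; auto; rewrite in_flat_map.
  destruct s; simpl in H.
  - destruct H as [(T & HT & HE) _]; exists T; split; auto; now apply edge_of_list.
  - destruct H as [(T & V & HT & HV & ->) _]; exists T; split; auto; now apply vertex_of_list.
Qed.

Lemma edge_of_within T e : nondeg T -> edge_of T e ->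
  within e T /\ forall i, lo e i <= hi e i.
Proof.
  intros HT (d & Hl & Hh & Ho).
  assert (K : forall i, lo T i <= lo e i /\ hi e i <= hi T i /\ lo e i <= hi e i).
  { intros i; specialize (HT i); destruct (excluded_middle_informative (i = d)) as [->|E]; [lra|].
    specialize (Ho i E); lra. }
  split; intros i; specialize (K i); lra.
Qed.

(* A patch contained in an element is a subface of that element, by conformity; so each
   element meets at most 12 edge patches, resp. 8 vertex patches. *)
Lemma patch_in_list St s k X T :
  valid_setup St -> patch_pred St s (S k) X -> In T (mesh St k) -> box_sub X T ->
  In X (patch_list s T).
Proof.
  intros V HX HT HS; pose proof (good_mesh_level St k V) as G.
  pose proof (gm_nondeg _ _ G _ HT) as N.
  destruct s; simpl in *; unfold coarse in HX; simpl in HX.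
  - destruct HX as [(T' & HT' & HE) _]; apply edge_of_list.
    pose proof (gm_nondeg _ _ G _ HT') as N'.
    destruct (edge_of_within _ _ N' HE) as [W' Hle].
    pose proof (box_sub_within _ _ Hle HS) as W.
    assert (Ha : forall i, aligned_at T T' i).
    { apply (gm_aligned (Om St) (mesh St k) _ _ (lo X)); auto; intros i;
        specialize (W i); specialize (W' i); specialize (Hle i); lra. }
    destruct HE as (d & Hl & Hh & Ho); exists d.
    (* Along [d] the edge spans all of [T'] while lying in [T], which rules out intervals that
       merely touch. *)
    assert (Hd : lo T d = lo T' d /\ hi T d = hi T' d).
    { specialize (Ha d); specialize (W d); specialize (N d); specialize (N' d).
      unfold aligned_at in Ha; lra. }
    destruct Hd as [-> ->]; repeat split; auto; destruct (Ho i H) as [E1 E2]; auto.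
    specialize (Ha i); specialize (W i); specialize (N i); specialize (N' i).
    unfold aligned_at in Ha; lra.
  - destruct HX as [(T' & V' & HT' & HE & ->) _]; apply vertex_of_list; intros i.
    pose proof (gm_nondeg _ _ G _ HT') as N'.
    assert (W : within (Box V' V') T) by (apply box_sub_within; auto; intros; simpl; lra).
    assert (Ha : forall i, aligned_at T T' i).
    { apply (gm_aligned (Om St) (mesh St k) _ _ V'); auto; intros j;
        specialize (W j); specialize (HE j); specialize (N' j); simpl in W; lra. }
    specialize (Ha i); specialize (W i); specialize (HE i); specialize (N i); specialize (N' i).
    unfold aligned_at in Ha; simpl in W; lra.
Qed.

(* The edge [e], lying in [T0], has its relative interior inside a subface [Y] of [T];
   conformity then forces [Y], and with it the patch centre [X], into [T0]. *)
Lemma allowed_in_element St k X e T0 :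
  valid_setup St -> In T0 (mesh St k) -> within e T0 -> (forall i, lo e i <= hi e i) ->
  allowed St (S k) X e -> box_sub X T0.
Proof.
  intros V HT0 We Hle (T & Y & HT & HXT & HY & HXY & Hrel).
  unfold coarse in HT; simpl in HT.
  pose proof (good_mesh_level St k V) as G.
  pose proof (gm_nondeg _ _ G _ HT) as N.
  assert (WY : within Y T).
  { destruct HY as [->|[HF|HE]].
    - intros i; lra.
    - destruct HF as (n & E & E' & Ho); intros i; specialize (N i).
      destruct (excluded_middle_informative (i = n)) as [->|D]; [lra|].
      specialize (Ho i D); lra.
    - now apply edge_of_within. }
  assert (Hx : relint e (mid e)) by (intros i; specialize (Hle i); unfold mid; lra).
  assert (Hx0 : in_closed T0 (mid e))
    by (intros i; specialize (We i); specialize (Hle i); unfold mid; lra).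
  apply Hrel in Hx.
  assert (HxT : in_closed T (mid e)).
  { intros i; specialize (Hx i); specialize (WY i); lra. }
  pose proof (gm_aligned _ _ _ _ _ G HT HT0 HxT Hx0) as Ha.
  intros x Xx; apply HXY in Xx; revert x Xx; apply within_box_sub.
  intros i; specialize (Ha i); specialize (Hx i); specialize (WY i); specialize (Hx0 i);
    specialize (N i); specialize (HxT i); pose proof (gm_nondeg _ _ G _ HT0 i);
    unfold aligned_at in Ha; lra.
Qed.

(** * Nedelec functions and the form [a] *)

(** One operation serves for all vector algebra: the coefficients 1 and -1 give [vadd] and
    [vsub]. *)
Definition vlin (c : R) (u v : vf) : vf := vadd u (vscale c v).

Definition subspace (S : vf -> Prop) : Prop :=
  S vzero /\ forall c u v, S u -> S v -> S (vlin c u v).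

Lemma third_axis (i j : ax) : i <> j -> exists n, i <> n /\ j <> n /\ forall l, l = i \/ l = j \/ l = n.
Proof.
  intros H; destruct i, j; try congruence;
  [exists A3 | exists A2 | exists A3 | exists A1 | exists A2 | exists A1];
  repeat split; try congruence; intros []; auto.
Qed.

Lemma upd_same x d t : upd x d t d = t.
Proof. unfold upd; now destruct d. Qed.

Lemma upd_other x d t i : i <> d -> upd x d t i = x i.
Proof. intros H; unfold upd; destruct i, d; simpl; congruence. Qed.

Lemma ned_form p d m n : is_ned_poly p -> d <> m -> m <> n -> d <> n ->
  exists c0 c1 c2 c3, forall x, p x d = c0 + c1 * x m + c2 * x n + c3 * x m * x n.
Proof.
  intros (a1 & a2 & a3 & a4 & b1 & b2 & b3 & b4 & c1 & c2 & c3 & c4 & H) Hdm Hmn Hdn.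
  destruct d, m, n; try congruence.
  - exists a1, a2, a3, a4; intros x; apply H.
  - exists a1, a3, a2, a4; intros x; rewrite (proj1 (H x)); ring.
  - exists b1, b3, b2, b4; intros x; rewrite (proj1 (proj2 (H x))); ring.
  - exists b1, b2, b3, b4; intros x; apply H.
  - exists c1, c2, c3, c4; intros x; apply H.
  - exists c1, c3, c2, c4; intros x; rewrite (proj2 (proj2 (H x))); ring.
Qed.

Lemma ned_zero : is_ned_poly vzero.
Proof. do 12 exists 0; intros x; unfold vzero; repeat split; ring. Qed.

Lemma ned_lin c p q : is_ned_poly p -> is_ned_poly q -> is_ned_poly (vlin c p q).
Proof.
  intros (a1 & a2 & a3 & a4 & b1 & b2 & b3 & b4 & c1 & c2 & c3 & c4 & H)
    (a1' & a2' & a3' & a4' & b1' & b2' & b3' & b4' & c1' & c2' & c3' & c4' & H').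
  exists (a1 + c * a1'), (a2 + c * a2'), (a3 + c * a3'), (a4 + c * a4'),
    (b1 + c * b1'), (b2 + c * b2'), (b3 + c * b3'), (b4 + c * b4'),
    (c1 + c * c1'), (c2 + c * c2'), (c3 + c * c3'), (c4 + c * c4').
  intros x; destruct (H x) as (E1 & E2 & E3), (H' x) as (E1' & E2' & E3').
  unfold vlin, vadd, vscale; rewrite E1, E2, E3, E1', E2', E3'; repeat split; ring.
Qed.

Definition corner (C : box) (s : ax -> bool) : pt := fun i => if s i then hi C i else lo C i.

Lemma bilinear_zero c0 c1 c2 c3 l h l' h' :
  l < h -> l' < h' ->
  c0 + c1 * l + c2 * l' + c3 * l * l' = 0 -> c0 + c1 * h + c2 * l' + c3 * h * l' = 0 ->
  c0 + c1 * l + c2 * h' + c3 * l * h' = 0 -> c0 + c1 * h + c2 * h' + c3 * h * h' = 0 ->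
  c0 = 0 /\ c1 = 0 /\ c2 = 0 /\ c3 = 0.
Proof.
  intros Hl Hl' E1 E2 E3 E4.
  assert (K3 : c3 * ((h - l) * (h' - l')) = 0) by lra.
  apply Rmult_integral in K3 as [->|K]; [|apply Rmult_integral in K; lra].
  assert (K1 : c1 * (h - l) = 0) by lra.
  apply Rmult_integral in K1 as [->|K]; [|lra].
  assert (K2 : c2 * (h' - l') = 0) by lra.
  apply Rmult_integral in K2 as [->|K]; lra.
Qed.

(** The component is bilinear in the two axes other than [d], hence determined by four corners. The
    lemma is applied both to interior sample points and to the ends of edges. *)
Lemma ned_comp_zero p d C : is_ned_poly p -> nondeg C ->
  (forall s, p (corner C s) d = 0) -> forall x, p x d = 0.
Proof.
  intros Hp HC H.
  assert (exists m n, d <> m /\ m <> n /\ d <> n) as (m & n & D1 & D2 & D3)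
    by (destruct d; [exists A2, A3 | exists A1, A3 | exists A1, A2]; repeat split; congruence).
  destruct (ned_form p d m n Hp D1 D2 D3) as (c0 & c1 & c2 & c3 & E).
  pose (s := fun b b' i => if ax_eqb i m then b else b' : bool).
  assert (Em : forall b b', s b b' m = b) by (intros; unfold s; now destruct m).
  assert (En : forall b b', s b b' n = b')
    by (intros; unfold s; destruct m, n; simpl; congruence).
  pose proof (H (s false false)) as H1; pose proof (H (s true false)) as H2;
    pose proof (H (s false true)) as H3; pose proof (H (s true true)) as H4.
  rewrite E in H1, H2, H3, H4; unfold corner in *; rewrite Em, En in H1, H2, H3, H4.
  destruct (bilinear_zero c0 c1 c2 c3 _ _ _ _ (HC m) (HC n) H1 H2 H3 H4) as (-> & -> & -> & ->).
  intros x; rewrite E; ring.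
Qed.

(** The middle third in each direction: its corners lie in the open element, where a function agrees
    with its polynomial piece. *)
Definition core (B : box) : box :=
  Box (fun i => (2 * lo B i + hi B i) / 3) (fun i => (lo B i + 2 * hi B i) / 3).

Lemma core_nondeg B : nondeg B -> nondeg (core B).
Proof. intros H i; specialize (H i); simpl; lra. Qed.

Lemma core_corner_open B s : nondeg B -> in_open B (corner (core B) s).
Proof. intros H i; specialize (H i); unfold corner; simpl; destruct (s i); lra. Qed.

Lemma ned_zero_open p B : nondeg B -> is_ned_poly p ->
  (forall x, in_open B x -> forall i, p x i = 0) -> forall x i, p x i = 0.
Proof.
  intros HB Hp H x i; apply (ned_comp_zero p i (core B)); auto.
  - now apply core_nondeg.
  - intros s; now apply H, core_corner_open.
Qed.

Lemma piece_lin u v B p q c : piece_of u B p -> piece_of v B q ->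
  piece_of (vlin c u v) B (vlin c p q).
Proof.
  intros [Hp Ep] [Hq Eq]; split; [now apply ned_lin|].
  intros x Hx i; unfold vlin, vadd, vscale; now rewrite Ep, Eq.
Qed.

Lemma piece_unique v B p q : nondeg B -> piece_of v B p -> piece_of v B q -> p = q.
Proof.
  intros HB [Hp Ep] [Hq Eq]; extensionality x; extensionality i.
  assert (K : vlin (-1) p q x i = 0).
  { apply (ned_zero_open _ B HB); [now apply ned_lin|].
    intros y Hy j; unfold vlin, vadd, vscale; rewrite <- Ep, <- Eq by auto; ring. }
  unfold vlin, vadd, vscale in K; lra.
Qed.

Lemma in_N_zero St k : valid_setup St -> in_N St k vzero.
Proof.
  intros V; pose proof (good_mesh_level St k V) as G.
  assert (Z : forall B p, In B (mesh St k) -> piece_of vzero B p -> p = vzero).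
  { intros B p HB Hp; apply (piece_unique vzero B); auto.
    - apply (gm_nondeg _ _ G _ HB).
    - split; [apply ned_zero | reflexivity]. }
  split; [|split; [|split]].
  - intros B _; exists vzero; split; [apply ned_zero | reflexivity].
  - reflexivity.
  - intros B B' p p' n x HB HB' Hp Hp' _ _ _ j _.
    rewrite (Z B p HB Hp), (Z B' p' HB' Hp'); reflexivity.
  - intros B p n x HB Hp _ _ _ j _; rewrite (Z B p HB Hp); reflexivity.
Qed.

Lemma in_N_lin St k c u v : valid_setup St -> in_N St k u -> in_N St k v -> in_N St k (vlin c u v).
Proof.
  intros V (U1 & U2 & U3 & U4) (V1 & V2 & V3 & V4).
  pose proof (good_mesh_level St k V) as G.
  assert (Z : forall B p, In B (mesh St k) -> piece_of (vlin c u v) B p ->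
     exists q r, piece_of u B q /\ piece_of v B r /\ p = vlin c q r).
  { intros B p HB Hp; destruct (U1 B HB) as [q Hq], (V1 B HB) as [r Hr].
    exists q, r; repeat split; try apply Hq; try apply Hr.
    apply (piece_unique (vlin c u v) B); auto; [apply (gm_nondeg _ _ G _ HB)|].
    now apply piece_lin. }
  split; [|split; [|split]].
  - intros B HB; destruct (U1 B HB) as [q Hq], (V1 B HB) as [r Hr].
    exists (vlin c q r); now apply piece_lin.
  - intros x Hx i; unfold vlin, vadd, vscale; rewrite U2, V2 by auto; ring.
  - intros B B' p p' n x HB HB' Hp Hp' E E' Hx j Hj.
    destruct (Z B p HB Hp) as (q & r & Hq & Hr & ->), (Z B' p' HB' Hp') as (q' & r' & Hq' & Hr' & ->).
    unfold vlin, vadd, vscale.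
    rewrite (U3 B B' q q' n x), (V3 B B' r r' n x); auto.
  - intros B p n x HB Hp Hc E Hx j Hj.
    destruct (Z B p HB Hp) as (q & r & Hq & Hr & ->); unfold vlin, vadd, vscale.
    rewrite (U4 B q n x), (V4 B r n x); auto; ring.
Qed.

Lemma subspace_N St k : valid_setup St -> subspace (in_N St k).
Proof. intros V; split; [now apply in_N_zero | intros; now apply in_N_lin]. Qed.

(** Finitely many linear functionals that separate [in_N], taking the place of a finite basis in
    [riesz_projection]. Point values inside the elements make the separation a matter of one element
    at a time. *)
Definition evaluations (l : list box) : list (vf -> R) :=
  flat_map (fun B => flat_map (fun s => map (fun i (v : vf) => v (corner (core B) s) i) [A1; A2; A3])
    [sel false false false; sel false false true; sel false true false; sel false true true;
     sel true false false; sel true false true; sel true true false; sel true true true]) l.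

Lemma evaluations_lin l phi c u v :
  In phi (evaluations l) -> phi (vlin c u v) = phi u + c * phi v.
Proof.
  unfold evaluations; rewrite in_flat_map; intros (B & _ & H).
  apply in_flat_map in H as (s & _ & H); apply in_map_iff in H as (i & <- & _); reflexivity.
Qed.

Lemma evaluations_separate St k v : valid_setup St -> in_N St k v ->
  (forall phi, In phi (evaluations (mesh St k)) -> phi v = 0) -> v = vzero.
Proof.
  intros V Hv H; pose proof (good_mesh_level St k V) as G.
  extensionality x; extensionality i.
  destruct (excluded_middle_informative (exists B, In B (mesh St k) /\ in_open B x)) as [(B & HB & Hx)|N].
  - destruct Hv as (V1 & _); destruct (V1 B HB) as (p & Hp & E).
    pose proof (gm_nondeg _ _ G _ HB) as HN.
    rewrite (E x Hx); apply (ned_comp_zero p i (core B)); auto; [now apply core_nondeg|].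
    intros s; rewrite <- E by now apply core_corner_open.
    apply (H (fun v => v (corner (core B) s) i)), in_flat_map; exists B; split; auto.
    apply in_flat_map; exists s; split; [|apply in_map_iff; exists i; split; auto; destruct i; simpl; tauto].
    replace s with (sel (s A1) (s A2) (s A3)) by (extensionality j; now destruct j).
    destruct (s A1), (s A2), (s A3); simpl; tauto.
  - apply Hv; intros B HB Hx; apply N; now exists B.
Qed.

(** * The energy density and the bilinearity of the form *)

Definition dens (St : setup) (w v : vf) (x : pt) : R :=
  alpha St * dot (curl w x) (curl v x) + dot (w x) (v x).

Lemma locally_upd_open B x j : in_open B x -> locally (x j) (fun t => in_open B (upd x j t)).
Proof.
  intros H.
  assert (O : open (fun t => lo B j < t /\ t < hi B j))
    by (apply open_and; [apply open_gt | apply open_lt]).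
  generalize (O (x j) (H j)); apply filter_imp; intros t Ht i.
  destruct (excluded_middle_informative (i = j)) as [->|N].
  - rewrite upd_same; lra.
  - rewrite upd_other by auto; apply H.
Qed.

Lemma pd_ext u v B x i j : in_open B x -> (forall y, in_open B y -> u y i = v y i) ->
  pd u i j x = pd v i j x.
Proof.
  intros Hx H; apply Derive_ext_loc; generalize (locally_upd_open B x j Hx).
  apply filter_imp; auto.
Qed.

Lemma curl_ext u v B x : in_open B x -> (forall y, in_open B y -> forall i, u y i = v y i) ->
  curl u x = curl v x.
Proof.
  intros Hx H; extensionality i.
  assert (K : forall i j, pd u i j x = pd v i j x) by (intros; apply (pd_ext u v B); auto).
  destruct i; simpl; rewrite !K; reflexivity.
Qed.

Lemma dens_ext St u v u' v' B x : in_open B x ->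
  (forall y, in_open B y -> forall i, u y i = u' y i) ->
  (forall y, in_open B y -> forall i, v y i = v' y i) ->
  dens St u v x = dens St u' v' x.
Proof.
  intros Hx Hu Hv; unfold dens.
  rewrite (curl_ext u u' B x), (curl_ext v v' B x) by auto.
  unfold dot; now rewrite !Hu, !Hv.
Qed.

Lemma ned_is_derive p i j : is_ned_poly p -> i <> j ->
  exists n c1 c3, forall x, is_derive (fun t => p (upd x j t) i) (x j) (c1 + c3 * x n).
Proof.
  intros Hp Hij; destruct (third_axis i j Hij) as (n & Hin & Hjn & _).
  destruct (ned_form p i j n Hp Hij Hjn Hin) as (c0 & c1 & c2 & c3 & E).
  exists n, c1, c3; intros x.
  apply (is_derive_ext (fun t => c0 + c1 * t + c2 * x n + c3 * t * x n)).
  - intros t; rewrite E, upd_same, upd_other by congruence; reflexivity.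
  - auto_derive; auto; ring.
Qed.

Lemma Pol_pd p i j : is_ned_poly p -> i <> j -> Pol (pd p i j).
Proof.
  intros Hp Hij; destruct (ned_is_derive p i j Hp Hij) as (n & c1 & c3 & D).
  apply (Pol_ext (fun x => c1 + c3 * x n)).
  - intros x; symmetry; apply is_derive_unique, D.
  - apply Pol_lin; [apply Pol_const | apply Pol_coord].
Qed.

Lemma Pol_curl p i : is_ned_poly p -> Pol (fun x => curl p x i).
Proof.
  assert (S : forall f g, Pol f -> Pol g -> Pol (fun x => f x - g x)).
  { intros f g Hf Hg; apply (Pol_ext (fun x => f x + (-1) * g x)); [intros; ring|].
    now apply Pol_lin. }
  intros Hp; destruct i; simpl; apply S; apply Pol_pd; auto; congruence.
Qed.

Lemma Pol_ned p i : is_ned_poly p -> Pol (fun x => p x i).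
Proof.
  intros Hp.
  assert (exists m n, i <> m /\ m <> n /\ i <> n) as (m & n & D1 & D2 & D3)
    by (destruct i; [exists A2, A3 | exists A1, A3 | exists A1, A2]; repeat split; congruence).
  destruct (ned_form p i m n Hp D1 D2 D3) as (c0 & c1 & c2 & c3 & E).
  apply (Pol_ext (fun x => c0 + c1 * x m + c2 * x n + c3 * (x m * x n))).
  - intros x; rewrite E; ring.
  - repeat apply Pol_add; try apply Pol_scal; try apply Pol_mult;
      try apply Pol_coord; apply Pol_const.
Qed.

Lemma Pol_dens St p q : is_ned_poly p -> is_ned_poly q -> Pol (dens St p q).
Proof.
  intros Hp Hq; unfold dens, dot.
  repeat apply Pol_add; try apply Pol_scal; repeat apply Pol_add; apply Pol_mult;
    first [now apply Pol_curl | now apply Pol_ned].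
Qed.

Lemma dens_piece St w v B p q x : piece_of w B p -> piece_of v B q -> in_open B x ->
  dens St w v x = dens St p q x.
Proof. intros [_ Ep] [_ Eq] Hx; now apply (dens_ext St w v p q B x). Qed.

Lemma curl_vlin_ned c p q x i : is_ned_poly p -> is_ned_poly q ->
  curl (vlin c p q) x i = curl p x i + c * curl q x i.
Proof.
  intros Hp Hq.
  assert (K : forall i j, i <> j -> pd (vlin c p q) i j x = pd p i j x + c * pd q i j x).
  { intros i' j Hij; destruct (ned_is_derive p i' j Hp Hij) as (n & d1 & d3 & D),
      (ned_is_derive q i' j Hq Hij) as (n' & d1' & d3' & D').
    replace (pd p i' j x) with (d1 + d3 * x n) by (symmetry; apply is_derive_unique, D).
    replace (pd q i' j x) with (d1' + d3' * x n') by (symmetry; apply is_derive_unique, D').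
    apply is_derive_unique.
    apply (is_derive_plus (fun t => p (upd x j t) i')); auto.
    exact (is_derive_scal _ _ c _ (D' x)). }
  destruct i; simpl; rewrite !K by congruence; ring.
Qed.

Lemma dens_lin St k c u v w B x : in_N St k u -> in_N St k v -> in_N St k w ->
  In B (mesh St k) -> in_open B x ->
  dens St (vlin c u v) w x = dens St u w x + c * dens St v w x.
Proof.
  intros (U & _) (V & _) (W & _) HB Hx.
  destruct (U B HB) as [p Hp], (V B HB) as [q Hq], (W B HB) as [r Hr].
  rewrite (dens_piece St _ w B (vlin c p q) r x) by auto using piece_lin.
  rewrite (dens_piece St u w B p r x), (dens_piece St v w B q r x) by auto.
  unfold dens, dot; rewrite !curl_vlin_ned by (apply Hp || apply Hq).
  unfold vlin, vadd, vscale; ring.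
Qed.

Lemma dens_sym St u v : dens St u v = dens St v u.
Proof. extensionality x; unfold dens, dot; ring. Qed.

Lemma dens_ge_0 St v x : 0 < alpha St -> 0 <= dens St v v x.
Proof.
  intros Ha; unfold dens, dot.
  assert (0 <= curl v x A1 * curl v x A1 + curl v x A2 * curl v x A2 + curl v x A3 * curl v x A3) by nra.
  assert (0 <= v x A1 * v x A1 + v x A2 * v x A2 + v x A3 * v x A3) by nra.
  nra.
Qed.

Lemma setup_nondeg St : valid_setup St -> nondeg (Om St).
Proof. intros [H _]; exact H. Qed.

(** A partition of unity off the mesh planes, used to cut the density into elementwise
    polynomials. *)
Lemma sum_ind O l x B : good_mesh O l -> In B l -> in_open B x ->
  rsum (map (fun C => ind C x) l) = 1.
Proof.
  intros G HB Hx.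
  assert (K : forall l', incl l' l -> NoDup l' ->
    rsum (map (fun C => ind C x) l') = if excluded_middle_informative (In B l') then 1 else 0).
  { induction l' as [|C l' IH]; intros Hi Hn; simpl.
    - destruct excluded_middle_informative; [contradiction | reflexivity].
    - inversion Hn; subst; rewrite IH by (auto; intros z Hz; apply Hi; now right).
      unfold ind; destruct (excluded_middle_informative (in_open C x)) as [HC|HC].
      + assert (C = B) as -> by (apply (gm_disjoint O l _ _ x); auto; apply Hi; now left).
        destruct excluded_middle_informative; [contradiction|].
        destruct excluded_middle_informative as [|N]; [ring | exfalso; apply N; now left].
      + destruct (excluded_middle_informative (In B l')) as [I|I];
        destruct excluded_middle_informative as [I'|I']; try ring.
        * exfalso; apply I'; now right.
        * destruct I' as [->|I']; contradiction. }
  rewrite K; [|intros z; auto | apply (gm_nodup _ _ G)].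
  destruct excluded_middle_informative; [reflexivity | contradiction].
Qed.

(** Multiplied by one element indicator, the density is that of two polynomial pieces; the sum of
    the indicators is 1 at generic points. *)
Lemma dens_integrable St k w v : valid_setup St -> in_N St k w -> in_N St k v ->
  integrable3 (Om St) (dens St w v).
Proof.
  intros V (W & _) (U & _); pose proof (good_mesh_level St k V) as G.
  assert (K : forall l, incl l (mesh St k) ->
    integrable3 (Om St) (fun x => rsum (map (fun C => ind C x) l) * dens St w v x)).
  { induction l as [|C l IH]; intros Hi; simpl.
    - exists 0; apply (is_RInt3_ext _ (setup_nondeg _ V) (fun _ => 0) _ nil); [intros; ring|].
      apply is_RInt3_zero.
    - assert (HC : In C (mesh St k)) by (apply Hi; now left).
      destruct IH as [v1 H1]; [intros z Hz; apply Hi; now right|].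
      destruct (W C HC) as [p Hp], (U C HC) as [q Hq].
      destruct (integrable3_ind_Pol (Om St) (setup_nondeg _ V) C (dens St p q)) as [v2 H2].
      + apply (gm_nondeg _ _ G _ HC).
      + apply (gm_within _ _ G _ HC).
      + apply Pol_dens; [apply Hp | apply Hq].
      + exists (v1 + 1 * v2).
        eapply (is_RInt3_ext _ (setup_nondeg _ V) _ _ nil); [|exact (is_RInt3_lin _ _ _ 1 _ _ H1 H2)].
        intros x _; cbv beta; unfold ind at 2 3; destruct excluded_middle_informative as [Hx|Hx];
          [rewrite (dens_piece St w v C p q x) by auto|]; ring. }
  destruct (K (mesh St k) (incl_refl _)) as [I HI]; exists I.
  apply (is_RInt3_ext _ (setup_nondeg _ V) (fun x => rsum (map (fun C => ind C x) (mesh St k)) * dens St w v x)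
    _ (coords (mesh St k))); auto.
  intros x Hx; destruct (generic_in_open _ _ x G Hx) as (B & HB & Ho).
  rewrite (sum_ind _ _ x B G HB Ho); ring.
Qed.

Lemma is_RInt3_a St k w v : valid_setup St -> in_N St k w -> in_N St k v ->
  is_RInt3 (Om St) (dens St w v) (a St w v).
Proof.
  intros V Hw Hv; apply RInt3_correct; [now apply setup_nondeg | now apply (dens_integrable St k)].
Qed.

Lemma a_lin St k c u v w : valid_setup St -> in_N St k u -> in_N St k v -> in_N St k w ->
  a St (vlin c u v) w = a St u w + c * a St v w.
Proof.
  intros V Hu Hv Hw; apply is_RInt3_unique; [now apply setup_nondeg|].
  apply (is_RInt3_ext _ (setup_nondeg _ V) (fun x => dens St u w x + c * dens St v w x)
    _ (coords (mesh St k))).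
  - intros x Hx; destruct (generic_in_open _ _ x (good_mesh_level St k V) Hx) as (B & HB & Ho).
    symmetry; now apply (dens_lin St k c u v w B).
  - apply is_RInt3_lin; now apply (is_RInt3_a St k).
Qed.

Lemma a_sym St u v : a St u v = a St v u.
Proof. unfold a; fold (dens St u v); fold (dens St v u); now rewrite dens_sym. Qed.

Lemma a_ge_0 St k v : valid_setup St -> 0 < alpha St -> in_N St k v -> 0 <= a St v v.
Proof.
  intros V Ha Hv; apply (is_RInt3_ge_0 _ (setup_nondeg _ V) (dens St v v) nil).
  - intros; now apply dens_ge_0.
  - now apply (is_RInt3_a St k).
Qed.

(** Used for [a] itself, for the density at a fixed point, and for [b (T u) v] with a nonnegative
    symmetric operator [T]. The density at a point has many null vectors, so semidefiniteness is the
    right generality. *)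
Definition psd_form (S : vf -> Prop) (b : vf -> vf -> R) : Prop :=
  (forall c u v w, S u -> S v -> S w -> b (vlin c u v) w = b u w + c * b v w) /\
  (forall u v, S u -> S v -> b u v = b v u) /\ (forall u, S u -> 0 <= b u u).

Lemma psd_a St k : valid_setup St -> 0 < alpha St -> psd_form (in_N St k) (a St).
Proof.
  intros V Ha; split; [|split].
  - intros; now apply (a_lin St k).
  - intros; apply a_sym.
  - intros; now apply (a_ge_0 St k).
Qed.

(** * Semidefinite forms and the multigrid algebra *)

Lemma vadd_vlin u v : vadd u v = vlin 1 u v.
Proof. extensionality x; extensionality i; unfold vlin, vadd, vscale; ring. Qed.

Lemma vsub_vlin u v : vsub u v = vlin (-1) u v.
Proof. extensionality x; extensionality i; unfold vlin, vsub, vadd, vscale; ring. Qed.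

Section Forms.

Variables (S : vf -> Prop) (b : vf -> vf -> R).
Hypothesis HS : subspace S.
Hypothesis Hb : psd_form S b.

Lemma form_lin c u v w : S u -> S v -> S w -> b (vlin c u v) w = b u w + c * b v w.
Proof. apply Hb. Qed.

Lemma form_sym u v : S u -> S v -> b u v = b v u.
Proof. apply Hb. Qed.

Lemma form_ge_0 u : S u -> 0 <= b u u.
Proof. apply Hb. Qed.

Lemma subspace_lin c u v : S u -> S v -> S (vlin c u v).
Proof. apply HS. Qed.

Lemma form_lin_r c u v w : S u -> S v -> S w -> b w (vlin c u v) = b w u + c * b w v.
Proof.
  intros Hu Hv Hw; rewrite !(form_sym w) by auto using subspace_lin.
  now apply form_lin.
Qed.

Lemma form_square c u v : S u -> S v ->
  b (vlin c u v) (vlin c u v) = b u u + 2 * c * b u v + c * c * b v v.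
Proof.
  intros Hu Hv; rewrite form_lin, !form_lin_r by auto using subspace_lin.
  rewrite (form_sym v u) by auto; ring.
Qed.

Lemma form_zero v : S v -> b vzero v = 0.
Proof.
  intros Hv; replace vzero with (vlin (-1) v v).
  - rewrite form_lin by auto; ring.
  - extensionality x; extensionality i; unfold vlin, vadd, vscale, vzero; ring.
Qed.

Lemma form_young t u v : 0 < t -> S u -> S v -> 2 * b u v <= t * b u u + / t * b v v.
Proof.
  intros Ht Hu Hv.
  pose proof (form_ge_0 (vlin (- / t) u v) (subspace_lin _ _ _ Hu Hv)) as H.
  rewrite form_square in H by auto.
  assert (E : t * (b u u + 2 * - / t * b u v + - / t * - / t * b v v)
            = t * b u u - 2 * b u v + / t * b v v) by (field; lra).
  assert (0 <= t * (b u u + 2 * - / t * b u v + - / t * - / t * b v v))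
    by (apply Rmult_le_pos; lra).
  lra.
Qed.

Lemma form_null u v : S u -> S v -> b u u = 0 -> b u v = 0.
Proof.
  intros Hu Hv H0.
  assert (K : forall c, 0 <= b v v + 2 * c * b u v).
  { intros c; pose proof (form_ge_0 (vlin c v u) (subspace_lin _ _ _ Hv Hu)) as H.
    rewrite form_square, H0, (form_sym v u) in H by auto; lra. }
  destruct (Req_dec (b u v) 0) as [E|N]; auto; exfalso.
  (* This [c] gives the affine lower bound the value -1. *)
  specialize (K (- (b v v + 1) / (2 * b u v))).
  replace (2 * (- (b v v + 1) / (2 * b u v)) * b u v) with (- (b v v + 1)) in K by (field; auto).
  lra.
Qed.

Lemma vsum_in {I} (l : list I) (w : I -> vf) :
  (forall i, In i l -> S (w i)) -> S (vsum (map w l)).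
Proof.
  induction l as [|i l IH]; intros H; simpl; [apply HS|].
  rewrite vadd_vlin; apply subspace_lin; [apply H; now left | apply IH; intros; apply H; now right].
Qed.

Lemma form_vsum {I} (l : list I) (w : I -> vf) v : S v -> (forall i, In i l -> S (w i)) ->
  b (vsum (map w l)) v = rsum (map (fun i => b (w i) v) l).
Proof.
  intros Hv; induction l as [|i l IH]; intros H; simpl; [now apply form_zero|].
  assert (H' : forall j, In j l -> S (w j)) by (intros; apply H; now right).
  rewrite vadd_vlin, form_lin, IH by (auto using vsum_in; apply H; now left).
  ring.
Qed.

Lemma rsum_ge_0 {I} (l : list I) (f : I -> R) :
  (forall i, In i l -> 0 <= f i) -> 0 <= rsum (map f l).
Proof.
  induction l as [|i l IH]; intros H; simpl; [lra|].
  pose proof (H i (or_introl eq_refl)).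
  assert (0 <= rsum (map f l)) by (apply IH; intros; apply H; now right).
  lra.
Qed.

(** Null terms are orthogonal to everything and do not count. Adding a nonnull term to n earlier
    ones, Young with weight n turns the factor n into n + 1. *)
Lemma form_overlap {I} (l l' : list I) (w : I -> vf) :
  NoDup l -> (forall i, In i l -> S (w i)) ->
  (forall i, In i l -> b (w i) (w i) <> 0 -> In i l') ->
  b (vsum (map w l)) (vsum (map w l)) <= INR (length l') * rsum (map (fun i => b (w i) (w i)) l).
Proof.
  intros Hn HS' Hl.
  pose (ch := fun i => if excluded_middle_informative (b (w i) (w i) = 0) then false else true).
  assert (Hc : INR (length (filter ch l)) <= INR (length l')).
  { apply le_INR, NoDup_incl_length; [now apply NoDup_filter|].
    intros i Hi; apply filter_In in Hi as [Hi Hc]; apply Hl; auto.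
    unfold ch in Hc; destruct excluded_middle_informative; [discriminate | auto]. }
  apply Rle_trans with (INR (length (filter ch l)) * rsum (map (fun i => b (w i) (w i)) l)).
  2:{ apply Rmult_le_compat_r; auto; apply rsum_ge_0; intros; apply form_ge_0; auto. }
  clear Hn Hl Hc l'; induction l as [|i l IH]; simpl; [rewrite form_zero by apply HS; lra|].
  assert (H' : forall j, In j l -> S (w j)) by (intros; apply HS'; now right).
  assert (Hi : S (w i)) by (apply HS'; now left).
  specialize (IH H').
  assert (Hs : S (vsum (map w l))) by now apply vsum_in.
  rewrite vadd_vlin, form_square by auto.
  set (s := vsum (map w l)) in *.
  set (q := rsum (map (fun i => b (w i) (w i)) l)) in *.
  assert (Hq : 0 <= q) by (apply rsum_ge_0; intros; apply form_ge_0; auto).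
  pose proof (form_ge_0 _ Hi) as Pi; pose proof (form_ge_0 _ Hs) as Ps.
  unfold ch at 1; destruct excluded_middle_informative as [Z|Z].
  - rewrite (form_null (w i) s), Z by auto; lra.
  - cbv iota; change (length (i :: filter ch l)) with (Datatypes.S (length (filter ch l))).
    rewrite S_INR; destruct (Nat.eq_dec (length (filter ch l)) 0) as [E|E].
    (* With no earlier nonnull term the weight would be 0; but then the induction bound makes [s]
       null, hence orthogonal to [w i]. *)
    + rewrite E in *; simpl INR in *.
      rewrite (form_sym (w i) s), (form_null s (w i)) by (auto; lra); lra.
    + assert (P : 0 < INR (length (filter ch l))) by (apply lt_0_INR; lia).
      set (n := INR (length (filter ch l))) in *.
      pose proof (form_young n (w i) s P Hi Hs) as Y.
      assert (/ n * b s s <= q).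
      { replace q with (/ n * (n * q)) by (field; lra).
        apply Rmult_le_compat_l; [left; now apply Rinv_0_lt_compat | exact IH]. }
      lra.
Qed.

(* Orthogonal projection by induction on finitely many functionals separating [U]:
   one Gram-Schmidt step per functional. The form may be degenerate. *)
Lemma riesz_projection (phis : list (vf -> R)) : forall U,
  subspace U -> (forall v, U v -> S v) ->
  (forall phi, In phi phis -> forall c u v, phi (vlin c u v) = phi u + c * phi v) ->
  (forall v, U v -> (forall phi, In phi phis -> phi v = 0) -> v = vzero) ->
  forall w, S w -> exists z, U z /\ forall v, U v -> b z v = b w v.
Proof.
  induction phis as [|phi phis IH]; intros U HU HUS Hlin Hsep w Hw.
  - exists vzero; split; [apply HU|]; intros v Hv.
    rewrite (Hsep v Hv) by (intros ? []).
    rewrite form_zero, form_sym, form_zero by (auto; apply HS); reflexivity.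
  - destruct (excluded_middle_informative (exists u, U u /\ phi u <> 0)) as [(u & Hu & Hphi)|N].
    + assert (Lphi : forall c u v, phi (vlin c u v) = phi u + c * phi v) by (apply Hlin; now left).
      assert (IH' : forall w, S w -> exists z, (U z /\ phi z = 0) /\
                forall v, U v /\ phi v = 0 -> b z v = b w v).
      { apply IH.
        - split.
          + split; [apply HU|].
            replace vzero with (vlin (-1) u u); [rewrite Lphi; ring|].
            extensionality x; extensionality i; unfold vlin, vadd, vscale, vzero; ring.
          + intros c x y [Hx Ex] [Hy Ey]; split; [now apply HU | rewrite Lphi, Ex, Ey; ring].
        - intros v [Hv _]; auto.
        - intros psi Hpsi; apply Hlin; now right.
        - intros v [Hv Ev] Hz; apply Hsep; auto.
          intros psi [<-|Hpsi]; auto. }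
      destruct (IH' u (HUS _ Hu)) as (zu & [Hzu Ezu] & Ozu).
      destruct (IH' w Hw) as (zw & [Hzw Ezw] & Ozw).
      (* The Gram-Schmidt vector: orthogonal to the kernel of [phi] in [U], with [phi u'] still
         nonzero. *)
      set (u' := vlin (-1) u zu).
      assert (Hu' : U u') by now apply HU.
      assert (Ephi : phi u' <> 0) by (unfold u'; rewrite Lphi, Ezu; lra).
      assert (O : forall v, U v -> phi v = 0 -> b u' v = 0).
      { intros v Hv Ev; unfold u'; rewrite form_lin, Ozu by auto; ring. }
      (* A null [u'] is orthogonal to [w] as well, so [t = 0] solves the equation; this is where
         degeneracy is absorbed. *)
      assert (exists t, t * b u' u' = b w u') as [t Ht].
      { destruct (Req_dec (b u' u') 0) as [Z|Z].
        - exists 0; rewrite (form_sym w u'), (form_null u' w) by auto; ring.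
        - exists (b w u' / b u' u'); field; auto. }
      exists (vlin t zw u'); split; [now apply HU|]; intros v Hv.
      (* Splits the test function into a part in the kernel of [phi] and a multiple of [u']. *)
      set (s := phi v / phi u').
      set (v' := vlin (- s) v u').
      assert (Hv' : U v') by now apply HU.
      assert (Ev' : phi v' = 0) by (unfold v', s; rewrite Lphi; field; auto).
      replace v with (vlin s v' u').
      2:{ extensionality x; extensionality i; unfold v', vlin, vadd, vscale; ring. }
      rewrite form_lin_r by auto using subspace_lin.
      rewrite form_lin_r, !form_lin by auto.
      rewrite Ozw, (O v'), (form_sym zw u'), (O zw) by auto.
      rewrite <- Ht; ring.
    (* Here [phi] vanishes on [U], so the remaining functionals still separate it. *)
    + apply IH; auto.
      * intros psi Hpsi; apply Hlin; now right.
      * intros v Hv Hz; apply Hsep; auto; intros psi [<-|Hpsi]; auto.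
        destruct (Req_dec (phi v) 0); auto; exfalso; apply N; now exists v.
Qed.

(** * Additive Schwarz smoothing *)

Section Smoother.

Variables (I : Type) (l : list I) (U : I -> vf -> Prop) (P : I -> vf -> vf).
Variables (eta N : R).
Hypothesis HUS : forall i v, In i l -> U i v -> S v.
Hypothesis HP : forall i w, In i l -> S w ->
  U i (P i w) /\ forall v, U i v -> b (P i w) v = b w v.
Hypothesis Heta : 0 < eta.
Hypothesis HN : 0 < N.
Hypothesis HetaN : eta * N <= 1.

Definition schwarz (w : vf) : vf := vsum (map (fun i => P i w) l).
Definition energy (w : vf) : R := rsum (map (fun i => b (P i w) (P i w)) l).
Definition smooth (w : vf) : vf := vlin (- eta) w (schwarz w).

Hypothesis Hover : forall w, S w -> b (schwarz w) (schwarz w) <= N * energy w.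

Lemma local_in i w : In i l -> S w -> S (P i w).
Proof. intros Hi Hw; apply (HUS i); auto; now apply HP. Qed.

(** [P i v] is tested with the local vector [P i w]. This makes the Schwarz operator symmetric, with
    [energy] as its quadratic form. *)
Lemma local_form i w v : In i l -> S w -> S v -> b (P i w) v = b (P i w) (P i v).
Proof.
  intros Hi Hw Hv; rewrite form_sym by auto using local_in.
  rewrite (form_sym (P i w)) by auto using local_in.
  symmetry; apply HP; auto; now apply HP.
Qed.

Lemma schwarz_in w : S w -> S (schwarz w).
Proof. intros Hw; apply vsum_in; intros; now apply local_in. Qed.

Lemma schwarz_form w v : S w -> S v ->
  b (schwarz w) v = rsum (map (fun i => b (P i w) (P i v)) l).
Proof.
  intros Hw Hv; unfold schwarz; rewrite form_vsum by auto using local_in.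
  f_equal; apply map_ext_in; intros; now apply local_form.
Qed.

Lemma smooth_in w : S w -> S (smooth w).
Proof. intros Hw; apply subspace_lin; auto using schwarz_in. Qed.

Lemma smooth_sym w v : S w -> S v -> b (smooth w) v = b w (smooth v).
Proof.
  intros Hw Hv; unfold smooth; rewrite form_lin, form_lin_r by auto using schwarz_in.
  rewrite (form_sym w (schwarz v)), !schwarz_form by auto using schwarz_in.
  do 3 f_equal; apply map_ext_in; intros; apply form_sym; now apply local_in.
Qed.

Lemma smooth_energy w : S w -> b (smooth w) w = b w w - eta * energy w.
Proof.
  intros Hw; unfold smooth; rewrite form_lin, schwarz_form by auto using schwarz_in.
  unfold energy; ring.
Qed.

(** Write B for [schwarz]. Since [energy w] is b(Bw, w), Young with weight 1/N and the overlap bound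
    give 2 energy <= b(Bw, Bw)/N + N b(w, w) <= energy + N b(w, w); hence eta energy <= b(w, w). *)
Lemma smooth_ge_0 w : S w -> 0 <= b (smooth w) w.
Proof.
  intros Hw; rewrite smooth_energy by auto.
  pose proof (form_young (/ N) (schwarz w) w (Rinv_0_lt_compat _ HN) (schwarz_in _ Hw) Hw) as Y.
  rewrite schwarz_form, Rinv_inv in Y by auto; fold (energy w) in Y.
  assert (/ N * b (schwarz w) (schwarz w) <= energy w).
  { replace (energy w) with (/ N * (N * energy w)) by (field; lra).
    apply Rmult_le_compat_l; [left; now apply Rinv_0_lt_compat | now apply Hover]. }
  assert (eta * energy w <= eta * (N * b w w)) by (apply Rmult_le_compat_l; lra).
  pose proof (form_ge_0 w Hw); nra.
Qed.

(** Here b(w, w) = b(w, v) is the sum of b(d_i, P_i v). Young with weight 1/C bounds 2 b(w, w) by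
    b(w, w) + C energy(v), and one smoothing step lowers the quadratic form at v by eta energy(v),
    whence the constant C / eta. *)
Lemma stable_decomposition_bound C (d : I -> vf) w v :
  0 < C -> S w -> S v -> (forall i, In i l -> U i (d i)) -> w = vsum (map d l) ->
  rsum (map (fun i => b (d i) (d i)) l) <= C * b w w -> b w v = b w w ->
  b w w <= C / eta * (b v v - b (smooth v) v).
Proof.
  intros HC Hw Hv Hd Ew Hdec Horth.
  rewrite smooth_energy by auto.
  replace (C / eta * (b v v - (b v v - eta * energy v))) with (C * energy v) by (field; lra).
  assert (Hd' : forall i, In i l -> S (d i)) by (intros i Hi; apply (HUS i); auto).
  assert (K : 2 * b w v <= / C * rsum (map (fun i => b (d i) (d i)) l) + C * energy v).
  { rewrite Ew at 1; rewrite form_vsum by auto; unfold energy.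
    (* The induction runs over a sublist, because the hypotheses on [U] and [P] speak of members of
       the fixed list [l]. *)
    clear Ew Hdec; assert (Hin : incl l l) by apply incl_refl; revert Hin.
    generalize l at 1 3 4 5 as l'; induction l' as [|i l' IH]; intros Hin; simpl; [lra|].
    assert (Hi : In i l) by (apply Hin; now left).
    assert (Hl : incl l' l) by (intros j Hj; apply Hin; now right).
    specialize (IH Hl).
    pose proof (form_young (/ C) (d i) (P i v) (Rinv_0_lt_compat _ HC) (Hd' i Hi)
      (local_in i v Hi Hv)) as Y.
    assert (E : b (d i) v = b (d i) (P i v)).
    { rewrite form_sym by auto; rewrite (form_sym (d i)) by auto using local_in.
      symmetry; apply HP; auto. }
    rewrite Rinv_inv in Y; rewrite E; lra. }
  assert (/ C * rsum (map (fun i => b (d i) (d i)) l) <= b w w).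
  { replace (b w w) with (/ C * (C * b w w)) by (field; lra).
    apply Rmult_le_compat_l; [left; now apply Rinv_0_lt_compat | exact Hdec]. }
  lra.
Qed.

End Smoother.

(** * Powers of a symmetric nonnegative smoother *)

Variable T : vf -> vf.
Hypothesis T_in : forall v, S v -> S (T v).
Hypothesis T_sym : forall u v, S u -> S v -> b (T u) v = b u (T v).
Hypothesis T_ge_0 : forall v, S v -> 0 <= b (T v) v.

Lemma iter_in m v : S v -> S (Nat.iter m T v).
Proof. intros Hv; induction m; simpl; auto. Qed.

Lemma iter_sym m u v : S u -> S v -> b (Nat.iter m T u) v = b u (Nat.iter m T v).
Proof.
  revert v; induction m as [|m IH]; intros v Hu Hv; simpl; auto.
  rewrite T_sym, IH by auto using iter_in.
  rewrite <- Nat.iter_succ, Nat.iter_succ_r; reflexivity.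
Qed.

(* With c_j = b(T^j w, w), the differences c_j - c_(j+1) are nonincreasing, so
   c_0 - c_2m >= 2m (c_2m - c_(2m+1)). *)
Lemma smoothing_property m w : S w ->
  2 * INR m * (b (Nat.iter m T w) (Nat.iter m T w) - b (T (Nat.iter m T w)) (Nat.iter m T w))
  <= b w w - b (Nat.iter m T w) (Nat.iter m T w).
Proof.
  intros Hw; induction m as [|m IH]; [simpl; lra|].
  rewrite S_INR; simpl Nat.iter; set (v := Nat.iter m T w) in *.
  assert (Hv : S v) by now apply iter_in.
  assert (Hz : S (vlin (-1) v (T v))) by auto using subspace_lin.
  (* [K1] and [K2] say that two consecutive second differences of c_j are nonnegative: they are b(z,
     z) and b(Tz, z) at z = v - Tv. [T_sym] replaces linearity of [T] in expanding the second. *)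
  pose proof (form_ge_0 _ Hz) as K1; rewrite form_square in K1 by auto.
  pose proof (T_ge_0 _ Hz) as K2.
  rewrite form_lin_r, !T_sym, !form_lin in K2 by auto.
  rewrite (form_sym v (T v)) in K1, K2 by auto.
  rewrite <- (T_sym v (T v)) in K2 by auto.
  rewrite (T_sym (T v) (T v)) by auto.
  pose proof (pos_INR m).
  assert (2 * INR m * (b (T v) (T v) - b (T v) (T (T v)))
    <= 2 * INR m * (b v v - b (T v) v)) by (apply Rmult_le_compat_l; lra).
  lra.
Qed.

End Forms.

Definition contraction_form (S : vf -> Prop) (b : vf -> vf -> R) (gamma : R) (T : vf -> vf) : Prop :=
  (forall v, S v -> S (T v)) /\ (forall u v, S u -> S v -> b (T u) v = b u (T v)) /\
  (forall v, S v -> 0 <= b (T v) v <= gamma * b v v).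

(** Young with weight gamma for the form b(Tu, v), at w and Tw, plays the role of Cauchy-Schwarz: 2
    b(Tw, Tw) <= gamma^2 b(w, w) + b(Tw, Tw), and the last term is absorbed. *)
Lemma contraction_norm S b gamma T w : subspace S -> psd_form S b -> 0 < gamma ->
  contraction_form S b gamma T -> S w -> b (T w) (T w) <= gamma * gamma * b w w.
Proof.
  intros HS Hb Hg (T_in & T_sym & T_bd) Hw.
  assert (Hq : psd_form S (fun u v => b (T u) v)).
  { split; [|split].
    - intros c u v z Hu Hv Hz; rewrite T_sym by (auto; now apply HS).
      rewrite (form_lin S b Hb) by auto; rewrite <- !T_sym by auto; reflexivity.
    - intros u v Hu Hv; rewrite T_sym by auto; apply Hb; auto.
    - intros u Hu; now apply T_bd. }
  pose proof (form_young S _ HS Hq gamma w (T w) Hg Hw (T_in w Hw)) as Y.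
  simpl in Y.
  assert (gamma * b (T w) w <= gamma * (gamma * b w w))
    by (apply Rmult_le_compat_l; [lra | now apply T_bd]).
  assert (/ gamma * b (T (T w)) (T w) <= / gamma * (gamma * b (T w) (T w)))
    by (apply Rmult_le_compat_l; [left; now apply Rinv_0_lt_compat | apply T_bd; auto]).
  replace (/ gamma * (gamma * b (T w) (T w))) with (b (T w) (T w)) in * by (field; lra).
  lra.
Qed.

(** * Level transfer and local spaces *)

Lemma a_generic_ext St k u v u' v' : valid_setup St -> in_N St k u -> in_N St k v ->
  (forall B x, In B (mesh St k) -> in_open B x -> dens St u v x = dens St u' v' x) ->
  a St u' v' = a St u v.
Proof.
  intros V Hu Hv H; apply is_RInt3_unique; [now apply setup_nondeg|].
  apply (is_RInt3_ext _ (setup_nondeg _ V) (dens St u v) _ (coords (mesh St k)));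
    [|now apply (is_RInt3_a St k)].
  intros x Hx; destruct (generic_in_open _ _ x (good_mesh_level St k V) Hx) as (B & HB & Ho).
  now apply (H B).
Qed.

Lemma inj_open St k v B x : In B (mesh St k) -> in_open B x -> inj St k v x = v x.
Proof.
  intros HB Hx; unfold inj; destruct excluded_middle_informative as [|N]; auto.
  exfalso; apply N; now exists B.
Qed.

Lemma inj_lin St k c u v : inj St k (vlin c u v) = vlin c (inj St k u) (inj St k v).
Proof.
  extensionality x; extensionality i; unfold inj, vlin, vadd, vscale, vzero.
  destruct excluded_middle_informative; [reflexivity | ring].
Qed.

Lemma inj_zero St k : inj St k vzero = vzero.
Proof. extensionality x; unfold inj; now destruct excluded_middle_informative. Qed.

Lemma open_closed_eq O l B B' x : good_mesh O l -> In B l -> In B' l ->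
  in_open B x -> in_closed B' x -> B = B'.
Proof.
  intros G HB HB' Hx Hx'.
  pose proof (gm_aligned _ _ _ _ x G HB HB' (open_closed _ _ Hx) Hx') as Ha.
  apply box_ext; intros i; specialize (Ha i); specialize (Hx i); specialize (Hx' i);
    unfold aligned_at in Ha; lra.
Qed.

Lemma inj_piece St k v B T p q : valid_setup St -> In B (mesh St (S k)) -> within B T ->
  piece_of v T q -> piece_of (inj St (S k) v) B p -> p = q.
Proof.
  intros V HB HW [Hq Eq] Hp; pose proof (good_mesh_level St (S k) V) as G.
  apply (piece_unique (inj St (S k) v) B); auto; [apply (gm_nondeg _ _ G _ HB)|].
  split; auto; intros x Hx i; rewrite (inj_open St (S k) v B x) by auto.
  apply Eq; now apply (within_open B T).
Qed.

Lemma in_N_inj St k v : valid_setup St -> in_N St k v -> in_N St (S k) (inj St (S k) v).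
Proof.
  intros V (V1 & V2 & V3 & V4).
  pose proof (good_mesh_level St k V) as G; pose proof (good_mesh_level St (S k) V) as G'.
  split; [|split; [|split]].
  - intros B HB; destruct (mesh_parent St k B V HB) as (T & HT & HW), (V1 T HT) as (p & Hp & Ep).
    exists p; split; auto; intros x Hx i; rewrite (inj_open St (S k) v B x) by auto.
    apply Ep; now apply (within_open B T).
  - intros x Hx i; unfold inj; destruct excluded_middle_informative as [(B & HB & Ho)|N];
      [exfalso; now apply (Hx B) | reflexivity].
  - intros B B' p p' n x HB HB' Hp Hp' E E' Hx j Hj.
    destruct (mesh_parent St k B V HB) as (T & HT & HW), (V1 T HT) as (q & Hq).
    destruct (mesh_parent St k B' V HB') as (T' & HT' & HW'), (V1 T' HT') as (q' & Hq').
    rewrite (inj_piece St k v B T p q V HB HW Hq Hp), (inj_piece St k v B' T' p' q' V HB' HW' Hq' Hp').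
    pose proof (gm_nondeg _ _ G' _ HB) as N; pose proof (gm_nondeg _ _ G' _ HB') as N'.
    assert (Hxc : in_closed B x).
    { intros i; destruct (excluded_middle_informative (i = n)) as [->|D];
        [specialize (N n) | specialize (Hx i D)]; lra. }
    assert (Hxc' : in_closed B' x).
    { intros i; destruct (excluded_middle_informative (i = n)) as [->|D];
        [specialize (N' n) | specialize (Hx i D)]; lra. }
    assert (Ha : forall i, aligned_at T T' i)
      by (apply (gm_aligned _ _ _ _ x G HT HT'); [now apply (within_closed B) | now apply (within_closed B')]).
    assert (Hin : forall i, i <> n -> lo T i < x i < hi T i /\ lo T' i < x i < hi T' i).
    { intros i Hi; specialize (Hx i Hi); specialize (HW i); specialize (HW' i); lra. }
    (* Either the fine face is inside one coarse element, and both pieces are the same polynomial,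
       or it lies on a coarse face and coarse tangential continuity applies. *)
    assert (Hn : (lo T n = lo T' n /\ hi T n = hi T' n) \/ (hi T n = x n /\ lo T' n = x n)).
    { specialize (Ha n); specialize (HW n); specialize (HW' n); specialize (N n); specialize (N' n).
      unfold aligned_at in Ha; lra. }
    destruct Hn as [Hn|[Hn Hn']]; [|now apply (V3 T T' q q' n x)].
    assert (T = T') as <-.
    { apply box_ext; intros i; (destruct (excluded_middle_informative (i = n)) as [->|D]; [tauto|]);
        specialize (Ha i); specialize (Hin i D); unfold aligned_at in Ha; lra. }
    now rewrite (piece_unique v T q q' (gm_nondeg _ _ G _ HT) Hq Hq').
  - intros B p n x HB Hp Hc E Hx j Hj.
    destruct (mesh_parent St k B V HB) as (T & HT & HW), (V1 T HT) as (q & Hq).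
    rewrite (inj_piece St k v B T p q V HB HW Hq Hp).
    apply (V4 T q n x); auto; [now apply (within_closed B)|].
    intros i Hi; specialize (Hx i Hi); specialize (HW i); lra.
Qed.

Lemma a_inj St k u v : valid_setup St -> in_N St k u -> in_N St k v ->
  a St (inj St (S k) u) (inj St (S k) v) = a St u v.
Proof.
  intros V Hu Hv; symmetry; apply (a_generic_ext St (S k)); auto using in_N_inj.
  intros B x HB Hx; apply (dens_ext St _ _ _ _ B); auto;
    intros y Hy i; now rewrite (inj_open St (S k) _ B).
Qed.

(** * Supports of interior and patch functions *)

Definition vanishes_on (T : box) (v : vf) : Prop := forall x, in_open T x -> forall i, v x i = 0.

Lemma dens_vanish St T u v x : vanishes_on T u -> in_open T x -> dens St u v x = 0.
Proof.
  intros Hu Hx; rewrite (dens_ext St u v vzero v T x); auto.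
  assert (Z : curl vzero x = fun _ => 0).
  { assert (K : forall i j, pd vzero i j x = 0) by (intros; apply (Derive_const 0)).
    extensionality i; destruct i; simpl; rewrite !K; ring. }
  unfold dens; rewrite Z; unfold dot, vzero; ring.
Qed.

Lemma mesh_parent_open St k B x : valid_setup St -> In B (mesh St (S k)) -> in_open B x ->
  exists T, In T (mesh St k) /\ within B T /\ in_open T x.
Proof.
  intros V HB Hx; destruct (mesh_parent St k B V HB) as (T & HT & HW).
  exists T; split; [|split]; auto; now apply (within_open B T).
Qed.

Lemma a_disjoint_supports St k u v : valid_setup St -> in_N St (S k) u -> in_N St (S k) v ->
  (forall T, In T (mesh St k) -> vanishes_on T u \/ vanishes_on T v) -> a St u v = 0.
Proof.
  intros V Hu Hv H; apply is_RInt3_unique; [now apply setup_nondeg|].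
  apply (is_RInt3_ext _ (setup_nondeg _ V) (fun _ => 0) _ (coords (mesh St (S k))));
    [|apply is_RInt3_zero].
  intros x Hx; destruct (generic_in_open _ _ x (good_mesh_level St (S k) V) Hx) as (B & HB & Ho).
  destruct (mesh_parent_open St k B x V HB Ho) as (T & HT & _ & HxT).
  change (0 = dens St u v x); destruct (H T HT) as [Z|Z].
  - now rewrite (dens_vanish St T).
  - now rewrite dens_sym, (dens_vanish St T).
Qed.

Lemma NT_vanishes St k T T' u : valid_setup St -> In T (mesh St k) -> In T' (mesh St k) ->
  T <> T' -> NT St (S k) T u -> vanishes_on T' u.
Proof.
  intros V HT HT' D [_ Hu] x Hx i; pose proof (good_mesh_level St k V) as G; apply Hu.
  - apply (within_closed T'); [apply (gm_within _ _ G _ HT') | now apply open_closed].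
  - intros Hc; apply D; symmetry; now apply (open_closed_eq _ _ _ _ x G).
Qed.

(** Component [d] does not involve coordinate [d], so it is constant along edges in that direction
    and an edge moment is a multiple of a point value. *)
Lemma ned_upd p x d t : is_ned_poly p -> p (upd x d t) d = p x d.
Proof.
  intros (a1 & a2 & a3 & a4 & b1 & b2 & b3 & b4 & c1 & c2 & c3 & c4 & H).
  destruct (H (upd x d t)) as (E1 & E2 & E3), (H x) as (F1 & F2 & F3).
  destruct d; [rewrite E1, F1 | rewrite E2, F2 | rewrite E3, F3]; reflexivity.
Qed.

Lemma ned_dof p x d l h : is_ned_poly p -> RInt (fun t => p (upd x d t) d) l h = (h - l) * p x d.
Proof.
  intros Hp; rewrite (RInt_ext _ (fun _ => p x d)) by (intros; now apply ned_upd).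
  rewrite RInt_const; reflexivity.
Qed.

(** The boundary condition of [in_N] speaks only of the relative interior of a face, while [e] may
    bound that face. On the face the component is affine in the transverse coordinate, so its
    vanishing extends to the edge. *)
Lemma boundary_edge_zero St k v B e d p : valid_setup St -> in_N St k v ->
  In B (mesh St k) -> piece_of v B p -> within e B -> lo e d < hi e d ->
  on_boundary St e -> p (lo e) d = 0.
Proof.
  intros V (_ & _ & _ & V4) HB Hp HW Hd (n & En & EO).
  pose proof (gm_nondeg _ _ (good_mesh_level St k V) _ HB) as N.
  assert (Hdn : d <> n) by (intros ->; lra).
  destruct (third_axis d n Hdn) as (m & Hdm & Hnm & Hall).
  destruct (ned_form p d n m (proj1 Hp) Hdn Hnm Hdm) as (c0 & c1 & c2 & c3 & E).
  assert (K : forall t, lo B m < t < hi B m -> c0 + c1 * lo e n + c2 * t + c3 * lo e n * t = 0).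
  { intros t Ht; pose (x := upd (upd (mid B) n (lo e n)) m t).
    assert (Xm : x m = t) by apply upd_same.
    assert (Xn : x n = lo e n) by (unfold x; now rewrite upd_other, upd_same).
    assert (Xd : x d = mid B d) by (unfold x; now rewrite !upd_other).
    rewrite <- Xm, <- Xn, <- E; apply (V4 B p n x); auto.
    - intros i; destruct (Hall i) as [-> |[-> | ->]].
      + rewrite Xd; specialize (N d); unfold mid; lra.
      + rewrite Xn; specialize (HW n); lra.
      + rewrite Xm; lra.
    - rewrite Xn; auto.
    - intros i Hi; destruct (Hall i) as [-> |[-> | ->]]; [|congruence|].
      + rewrite Xd; specialize (N d); unfold mid; lra.
      + rewrite Xm; lra. }
  specialize (N m).
  (* Two distinct interior zeros determine the affine function. *)
  pose proof (K ((lo B m + hi B m) / 2) ltac:(lra)) as K1.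
  pose proof (K ((2 * lo B m + hi B m) / 3) ltac:(lra)) as K2.
  assert (Z : (c2 + c3 * lo e n) * (hi B m - lo B m) = 0) by lra.
  apply Rmult_integral in Z as [Z|Z]; [|lra].
  assert (E2 : forall t, c0 + c1 * lo e n + c2 * t + c3 * lo e n * t
                   = c0 + c1 * lo e n + (c2 + c3 * lo e n) * t) by (intros; ring).
  rewrite E, E2, Z; rewrite E2, Z in K1; lra.
Qed.

(** By [allowed_in_element], a fine edge in [T] cannot be allowed when [X] is outside [T]. Every
    edge of a child of [T] is then on the boundary or carries a zero degree of freedom, and the
    twelve edge values determine the piece. *)
Lemma NX_vanishes St k X T v : valid_setup St -> In T (mesh St k) -> ~ box_sub X T ->
  NX St (S k) X v -> vanishes_on T v.
Proof.
  intros V HT HXT (Hv & Hdof & _) x Hx i.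
  destruct (excluded_middle_informative (exists B, In B (mesh St (S k)) /\ in_open B x))
    as [(B & HB & Ho)|N].
  2:{ apply Hv; intros B HB HBx; apply N; now exists B. }
  destruct (mesh_parent_open St k B x V HB Ho) as (T' & HT' & HW & HxT).
  assert (T' = T) as -> by now apply (gm_disjoint _ _ _ _ x (good_mesh_level St k V)).
  pose proof (gm_nondeg _ _ (good_mesh_level St (S k) V) _ HB) as N.
  destruct (proj1 Hv B HB) as (p & Hp).
  rewrite (proj2 Hp x Ho); apply (ned_comp_zero p i B (proj1 Hp) N); intros s.
  set (e := edge B i s).
  assert (He : edge_of B e) by apply edge_edge_of.
  destruct (edge_of_within B e N He) as [We Hle].
  assert (Hi : lo e i < hi e i)
    by (simpl; replace (ax_eqb i i) with true by (now destruct i); apply N).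
  assert (Ec : p (lo e) i = p (corner B s) i).
  { replace (lo e) with (upd (corner B s) i (lo B i)); [now apply ned_upd, Hp|].
    extensionality j; unfold upd, corner; simpl; destruct (ax_eqb j i) eqn:Eji; auto.
    now replace j with i by (destruct j, i; simpl in Eji; congruence). }
  rewrite <- Ec; destruct (excluded_middle_informative (on_boundary St e)) as [Hb|Hb].
  - now apply (boundary_edge_zero St (S k) v B).
  - assert (D : dof_zero St (S k) v e).
    { apply Hdof; [split; [now exists B | auto]|].
      intros Hal; apply HXT; apply (allowed_in_element St k X e T); auto.
      intros j; specialize (We j); specialize (HW j); lra. }
    specialize (D i B p HB He Hi Hp); rewrite ned_dof in D by apply Hp.
    apply Rmult_integral in D as [D|D]; lra.
Qed.

Lemma subspace_NT St k T : valid_setup St -> subspace (NT St k T).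
Proof.
  intros V; split.
  - split; [now apply in_N_zero | reflexivity].
  - intros c u v [Hu Zu] [Hv Zv]; split; [now apply in_N_lin|].
    intros x Hx Hn i; unfold vlin, vadd, vscale; rewrite Zu, Zv by auto; ring.
Qed.

Lemma subspace_NX St k X : valid_setup St -> 0 < alpha St -> subspace (NX St k X).
Proof.
  intros V Ha; pose proof (psd_a St k V Ha) as Hpsd; pose proof (good_mesh_level St k V) as G.
  split.
  - split; [now apply in_N_zero|split].
    + intros e _ _ d B p HB _ _ Hp; rewrite ned_dof by apply Hp.
      assert (p = vzero) as ->; [|unfold vzero; apply Rmult_0_r].
      apply (piece_unique vzero B); auto; [apply (gm_nondeg _ _ G _ HB)|].
      split; [apply ned_zero | reflexivity].
    + intros T u _ _ [Hu _]; now apply (form_zero (in_N St k)).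
  - intros c u v (Hu & Du & Ou) (Hv & Dv & Ov); split; [now apply in_N_lin|split].
    + intros e He Hal d B p HB HBe Hd Hp.
      destruct (proj1 Hu B HB) as (q & Hq), (proj1 Hv B HB) as (r & Hr).
      rewrite (piece_unique (vlin c u v) B p (vlin c q r) (gm_nondeg _ _ G _ HB) Hp)
        by now apply piece_lin.
      pose proof (Du e He Hal d B q HB HBe Hd Hq) as D1.
      pose proof (Dv e He Hal d B r HB HBe Hd Hr) as D2.
      rewrite ned_dof in D1 by apply Hq; rewrite ned_dof in D2 by apply Hr.
      rewrite ned_dof by (apply ned_lin; [apply Hq | apply Hr]).
      unfold vlin, vadd, vscale; rewrite Rmult_plus_distr_l, D1.
      rewrite <- Rmult_assoc, (Rmult_comm _ c), Rmult_assoc, D2.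
      rewrite Rmult_0_r; apply Rplus_0_l.
    + intros T w HT HX Hw; rewrite (a_lin St k) by (auto; apply Hw).
      rewrite (Ou T w), (Ov T w) by auto; ring.
Qed.

Lemma local_projection St k U w : valid_setup St -> 0 < alpha St -> subspace U ->
  (forall v, U v -> in_N St k v) -> in_N St k w ->
  exists z, U z /\ forall v, U v -> a St z v = a St w v.
Proof.
  intros V Ha HU HUN Hw.
  apply (riesz_projection (in_N St k) (a St) (subspace_N St k V) (psd_a St k V Ha)
    (evaluations (mesh St k))); auto.
  - intros phi Hphi c u v; now apply (evaluations_lin (mesh St k)).
  - intros v Hv; apply (evaluations_separate St k); auto.
Qed.

(** A coarse representative may be nonzero on fine mesh planes and so fail to be in the fine space.
    The projection is made onto the injected image of the coarse space and pulled back by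
    [a_inj]. *)
Lemma Pproj_spec St k w : valid_setup St -> 0 < alpha St -> in_N St (S k) w ->
  in_N St k (Pproj St (S k) w) /\
  forall v, in_N St k v -> a St (Pproj St (S k) w) v = a St w (inj St (S k) v).
Proof.
  intros V Ha Hw; unfold Pproj; apply epsilon_spec; simpl pred.
  pose (U := fun u => exists z, in_N St k z /\ u = inj St (S k) z).
  destruct (local_projection St (S k) U w V Ha) as (u & (z & Hz & ->) & Hu); auto.
  - split.
    + exists vzero; split; [now apply in_N_zero | now rewrite inj_zero].
    + intros c u v (y & Hy & ->) (z & Hz & ->); exists (vlin c y z).
      split; [now apply in_N_lin | now rewrite inj_lin].
  - intros v (z & Hz & ->); now apply in_N_inj.
  - exists z; split; [assumption|]; intros v Hv.
    rewrite <- Hu by (exists v; split; [assumption | reflexivity]).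
    symmetry; apply a_inj; assumption.
Qed.

(** * The smoother and the V-cycle *)

Lemma vsum_app l1 l2 : vsum (l1 ++ l2) = vadd (vsum l1) (vsum l2).
Proof.
  extensionality x; extensionality i; unfold vadd; induction l1 as [|u l1 IH]; simpl.
  - unfold vzero; ring.
  - unfold vadd; rewrite IH; ring.
Qed.

Lemma rsum_app l1 l2 : rsum (l1 ++ l2) = rsum l1 + rsum l2.
Proof. induction l1 as [|u l1 IH]; simpl; [ring | rewrite IH; ring]. Qed.

Lemma psd_dens St k B x : valid_setup St -> 0 < alpha St -> In B (mesh St k) -> in_open B x ->
  psd_form (in_N St k) (fun u v => dens St u v x).
Proof.
  intros V Ha HB Hx; split; [|split].
  - intros; now apply (dens_lin St k c u v w B).
  - intros u v _ _; now rewrite dens_sym.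
  - intros; now apply dens_ge_0.
Qed.

Lemma is_RInt3_rsum {I} B (l : list I) (f : I -> pt -> R) (v : I -> R) : nondeg B ->
  (forall i, In i l -> is_RInt3 B (f i) (v i)) ->
  is_RInt3 B (fun x => rsum (map (fun i => f i x) l)) (rsum (map v l)).
Proof.
  intros HB; induction l as [|i l IH]; intros H; simpl; [apply is_RInt3_zero|].
  replace (v i + rsum (map v l)) with (v i + 1 * rsum (map v l)) by ring.
  eapply (is_RInt3_ext _ HB _ _ nil); [|apply is_RInt3_lin; [apply H; now left | apply IH; intros; apply H; now right]].
  intros x _; cbv beta; ring.
Qed.

(** [form_overlap] is applied to the density at each generic point, where only functions not
    vanishing on the surrounding coarse element count, and the result is integrated. *)
Lemma a_overlap St k (l : list box) (w : box -> vf) n : valid_setup St -> 0 < alpha St ->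
  NoDup l -> (forall X, In X l -> in_N St (S k) (w X)) ->
  (forall T, In T (mesh St k) -> exists l', (length l' <= n)%nat /\
     forall X, In X l -> ~ vanishes_on T (w X) -> In X l') ->
  a St (vsum (map w l)) (vsum (map w l)) <= INR n * rsum (map (fun X => a St (w X) (w X)) l).
Proof.
  intros V Ha Hn Hw Hl.
  pose proof (good_mesh_level St (S k) V) as G.
  assert (Hs : in_N St (S k) (vsum (map w l)))
    by (apply vsum_in; auto using subspace_N).
  set (s := vsum (map w l)) in *.
  pose proof (is_RInt3_rsum (Om St) l (fun X => dens St (w X) (w X)) (fun X => a St (w X) (w X))
    (setup_nondeg _ V) (fun X HX => is_RInt3_a St (S k) _ _ V (Hw X HX) (Hw X HX))) as I1.
  (* [I3] integrates n times the sum of the densities minus the density of [s]. *)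
  pose proof (is_RInt3_lin _ _ _ (- INR n) _ _ (is_RInt3_a St (S k) s s V Hs Hs) I1) as I2.
  pose proof (is_RInt3_lin _ _ _ (-1) _ _ (is_RInt3_zero (Om St)) I2) as I3.
  apply (is_RInt3_ge_0 _ (setup_nondeg _ V) _ (coords (mesh St (S k)))) in I3; [lra|].
  intros x Hx; destruct (generic_in_open _ _ x G Hx) as (B & HB & Ho).
  destruct (mesh_parent_open St k B x V HB Ho) as (T & HT & _ & HxT).
  destruct (Hl T HT) as (l' & Hlen & Hl').
  pose proof (form_overlap _ _ (subspace_N St (S k) V) (psd_dens St (S k) B x V Ha HB Ho)
    l l' w Hn Hw) as K; fold s in K; cbv beta in K.
  assert (K' : dens St s s x <= INR n * rsum (map (fun X => dens St (w X) (w X) x) l)).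
  { eapply Rle_trans; [apply K|].
    - intros X HX Hne; apply Hl'; auto; intros Hv; apply Hne; now apply (dens_vanish St T).
    - apply Rmult_le_compat_r; [|now apply le_INR].
      apply rsum_ge_0; intros; now apply dens_ge_0. }
  lra.
Qed.

Definition overlap (s : smoother) : nat := match s with EdgeS => 12 | VertexS => 8 end.

(** The sum type merges interior spaces ([inl]) and patch spaces ([inr]) into one Schwarz family. *)
Definition index (St : setup) (s : smoother) (k : nat) : list (box + box) :=
  map inl (coarse St k) ++ map inr (patches St s k).

Definition local_space (St : setup) (k : nat) (i : box + box) : vf -> Prop :=
  match i with inl T => NT St k T | inr X => NX St k X end.

Definition local_solve (St : setup) (k : nat) (i : box + box) (w : vf) : vf :=
  Ainv St (local_space St k i) (fun v => a St w v).

Lemma local_space_in St k i v : local_space St k i v -> in_N St k v.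
Proof. destruct i; intros H; apply H. Qed.

Lemma local_solve_spec St k i w : valid_setup St -> 0 < alpha St -> in_N St k w ->
  local_space St k i (local_solve St k i w) /\
  forall v, local_space St k i v -> a St (local_solve St k i w) v = a St w v.
Proof.
  intros V Ha Hw; unfold local_solve, Ainv; apply epsilon_spec.
  apply (local_projection St k); auto; [|intros; now apply (local_space_in St k i)].
  destruct i; [now apply subspace_NT | now apply subspace_NX].
Qed.

Lemma Rop_smooth St s eta k :
  Rop St s eta k = smooth (box + box) (index St s k) (local_solve St k) eta.
Proof.
  extensionality w; unfold Rop, Minv, smooth, schwarz, index.
  rewrite map_app, !map_map, vsum_app.
  extensionality x; extensionality i; unfold vlin, vsub, vadd, vscale, local_solve; simpl; ring.
Qed.

(** If [X] lies in [T], orthogonality is part of [NX]; otherwise the supports share no coarse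
    element. *)
Lemma NT_NX_orthogonal St k T X u v : valid_setup St -> In T (mesh St k) ->
  NT St (S k) T u -> NX St (S k) X v -> a St u v = 0.
Proof.
  intros V HT Hu Hv; destruct (excluded_middle_informative (box_sub X T)) as [HX|HX].
  - rewrite a_sym; now apply (proj2 (proj2 Hv) T).
  - apply (a_disjoint_supports St k); auto; [apply Hu | apply Hv|].
    intros T' HT'; destruct (excluded_middle_informative (T = T')) as [<-|D].
    + right; now apply (NX_vanishes St k X T).
    + left; now apply (NT_vanishes St k T T').
Qed.

(** One interior function and up to 12 or 8 patch functions meet at a point. Orthogonality of the
    two groups lets them be bounded separately, so the constant is 12 or 8 and not 13 or 9, as the
    range of eta requires. *)
Lemma schwarz_overlap St s k w : valid_setup St -> 0 < alpha St -> in_N St (S k) w ->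
  let P := local_solve St (S k) in
  let z := schwarz (box + box) (index St s (S k)) P w in
  a St z z <= INR (overlap s) * energy (a St) (box + box) (index St s (S k)) P w.
Proof.
  intros V Ha Hw; simpl.
  set (P := local_solve St (S k)).
  assert (HP : forall i, in_N St (S k) (P i w))
    by (intros i; apply (local_space_in _ _ i); now apply local_solve_spec).
  assert (HPs : forall i, local_space St (S k) i (P i w)) by (intros i; now apply local_solve_spec).
  unfold schwarz, energy, index; rewrite !map_app, !map_map, vsum_app, rsum_app, vadd_vlin.
  unfold coarse; simpl pred.
  pose proof (subspace_N St (S k) V) as HS; pose proof (psd_a St (S k) V Ha) as Hb.
  destruct (patches_spec St s (S k)) as [Hnd HX].
  set (u := vsum (map (fun T => P (inl T) w) (mesh St k))).
  set (v := vsum (map (fun X => P (inr X) w) (patches St s (S k)))).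
  assert (Hu : in_N St (S k) u) by (apply vsum_in; auto).
  assert (Hv : in_N St (S k) v) by (apply vsum_in; auto).
  assert (Z : forall l : list box, rsum (map (fun _ => 0) l) = 0)
    by (induction l as [|? l IH]; simpl; [|rewrite IH]; lra).
  assert (O : a St u v = 0).
  { unfold u; rewrite (form_vsum _ _ HS Hb) by auto.
    rewrite <- (Z (mesh St k)); f_equal; apply map_ext_in; intros T HT.
    rewrite a_sym; unfold v; rewrite (form_vsum _ _ HS Hb) by auto.
    rewrite <- (Z (patches St s (S k))); f_equal; apply map_ext_in; intros X _.
    rewrite a_sym; apply (NT_NX_orthogonal St k T X); auto.
    - apply (HPs (inl T)).
    - apply (HPs (inr X)). }
  rewrite (form_square _ _ HS Hb), O by auto.
  assert (Bu : a St u u <= INR 1 * rsum (map (fun T => a St (P (inl T) w) (P (inl T) w)) (mesh St k))).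
  { apply (a_overlap St k); auto; [apply (gm_nodup _ _ (good_mesh_level St k V))|].
    intros T HT; exists [T]; split; [auto|]; intros T' HT' Hne.
    destruct (excluded_middle_informative (T = T')) as [|D]; [now left|].
    exfalso; apply Hne, (NT_vanishes St k T' T); auto; apply (HPs (inl T')). }
  assert (Bv : a St v v <= INR (overlap s) *
      rsum (map (fun X => a St (P (inr X) w) (P (inr X) w)) (patches St s (S k)))).
  { apply (a_overlap St k); auto.
    intros T HT; exists (patch_list s T); split; [destruct s; simpl; lia|]; intros X HXin Hne.
    apply (patch_in_list St s k); auto; [now apply HX|].
    destruct (excluded_middle_informative (box_sub X T)) as [|D]; auto.
    exfalso; apply Hne, (NX_vanishes St k X); auto; apply (HPs (inr X)). }
  assert (Pu : 0 <= rsum (map (fun T => a St (P (inl T) w) (P (inl T) w)) (mesh St k)))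
    by (apply rsum_ge_0; intros; apply (a_ge_0 St (S k)); auto).
  assert (H1 : INR 1 <= INR (overlap s)) by (apply le_INR; destruct s; simpl; lia).
  assert (INR 1 * rsum (map (fun T => a St (P (inl T) w) (P (inl T) w)) (mesh St k)) <=
    INR (overlap s) * rsum (map (fun T => a St (P (inl T) w) (P (inl T) w)) (mesh St k)))
    by (apply Rmult_le_compat_r; auto).
  lra.
Qed.

Lemma eta_overlap s eta : 0 < eta -> eta <= eta_max s -> eta * INR (overlap s) <= 1.
Proof. intros H0 H; destruct s; simpl in *; lra. Qed.

Lemma Eop_contraction St s eta C m : valid_setup St -> 0 < alpha St ->
  0 < eta -> eta <= eta_max s -> 0 < C -> decomposition_constant St s C -> (1 <= m)%nat ->
  forall k, contraction_form (in_N St k) (a St) (C / eta / (C / eta + 2 * INR m)) (Eop St s eta m k).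
Proof.
  intros V Ha Heta Hmax HC Hdec Hm.
  assert (Hm' : 1 <= INR m) by (apply (le_INR 1); auto).
  set (K := C / eta).
  assert (HK : 0 < K) by (apply Rdiv_lt_0_compat; auto).
  set (gamma := K / (K + 2 * INR m)).
  assert (Hg : 0 < gamma) by (apply Rdiv_lt_0_compat; lra).
  assert (Hg1 : gamma <= 1) by (apply (Rmult_le_reg_r (K + 2 * INR m)); [lra|];
    unfold gamma; unfold Rdiv; rewrite Rmult_assoc, Rinv_l by lra; lra).
  assert (HgK : (1 - gamma) * K = gamma * (2 * INR m)) by (unfold gamma; field; lra).
  induction k as [|k (E_in & E_sym & E_bd)].
  - pose proof (subspace_N St 0 V) as HS; pose proof (psd_a St 0 V Ha) as Hb.
    split; [|split]; simpl.
    + intros; now apply in_N_zero.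
    + intros u v Hu Hv; rewrite (a_sym St u), !(form_zero _ _ Hb); auto.
    + intros v Hv; rewrite (form_zero _ _ Hb) by auto.
      pose proof (a_ge_0 St 0 v V Ha Hv); nra.
  - pose proof (subspace_N St (S k) V) as HS; pose proof (psd_a St (S k) V Ha) as Hb.
    set (l := index St s (S k)); set (P := local_solve St (S k)).
    set (U := local_space St (S k)).
    assert (HUS : forall i v, In i l -> U i v -> in_N St (S k) v)
      by (intros i v _; apply local_space_in).
    assert (HP : forall i w, In i l -> in_N St (S k) w ->
      U i (P i w) /\ forall v, U i v -> a St (P i w) v = a St w v)
      by (intros i w _ Hw; now apply local_solve_spec).
    assert (HN : 0 < INR (overlap s)) by (apply lt_0_INR; destruct s; simpl; lia).
    pose proof (eta_overlap s eta Heta Hmax) as HetaN.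
    set (T := Rop St s eta (S k)).
    assert (ET : T = smooth (box + box) l P eta) by apply Rop_smooth.
    assert (T_in : forall v, in_N St (S k) v -> in_N St (S k) (T v))
      by (intros v Hv; rewrite ET; now apply (smooth_in _ (a St) HS (box + box) l U)).
    assert (T_sym : forall u v, in_N St (S k) u -> in_N St (S k) v -> a St (T u) v = a St u (T v))
      by (intros u v Hu Hv; rewrite ET; now apply (smooth_sym _ _ HS Hb (box + box) l U)).
    assert (T_ge_0 : forall v, in_N St (S k) v -> 0 <= a St (T v) v).
    { intros v Hv; rewrite ET; apply (smooth_ge_0 _ _ HS Hb (box + box) l U P eta (INR (overlap s))); auto.
      intros w Hw; now apply schwarz_overlap. }
    pose (r := fun w => Nat.iter m T w).
    assert (Hr : forall w, in_N St (S k) w -> in_N St (S k) (r w))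
      by (intros; now apply iter_in).
    assert (r_sym : forall u v, in_N St (S k) u -> in_N St (S k) v -> a St (r u) v = a St u (r v))
      by (intros; now apply (iter_sym (in_N St (S k)))).
    pose (p := fun w => Pproj St (S k) (r w)).
    assert (Hp : forall w, in_N St (S k) w -> in_N St k (p w))
      by (intros w Hw; exact (proj1 (Pproj_spec St k (r w) V Ha (Hr w Hw)))).
    assert (p_form : forall w v, in_N St (S k) w -> in_N St k v ->
      a St (inj St (S k) v) (r w) = a St (p w) v).
    { intros w v Hw Hv; rewrite a_sym; symmetry.
      exact (proj2 (Pproj_spec St k (r w) V Ha (Hr w Hw)) v Hv). }
    pose (z := fun w => vsub (r w) (inj St (S k) (p w))).
    assert (Hz : forall w, in_N St (S k) w -> in_N St (S k) (z w)).
    { intros w Hw; unfold z; rewrite vsub_vlin; apply in_N_lin; auto using in_N_inj. }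
    assert (EE : forall w, Eop St s eta m (S k) w =
       vadd (r (z w)) (r (inj St (S k) (Eop St s eta m k (p w))))) by reflexivity.
    assert (z_form : forall u v, in_N St (S k) u -> in_N St (S k) v ->
      a St (z u) (r v) = a St (r u) (r v) - a St (p u) (p v)).
    { intros u v Hu Hv; unfold z; rewrite vsub_vlin, (form_lin _ _ Hb), p_form by auto using in_N_inj.
      rewrite (a_sym St (p v)); ring. }
    (* Symmetry and both bounds are read off this formula, in which [u] and [v] enter alike through
       [r] and [p]. *)
    assert (E_form : forall u v, in_N St (S k) u -> in_N St (S k) v ->
      a St (Eop St s eta m (S k) u) v =
      a St (r u) (r v) - a St (p u) (p v) + a St (Eop St s eta m k (p u)) (p v)).
    { intros u v Hu Hv; rewrite EE, vadd_vlin, (form_lin _ _ Hb) by auto using in_N_inj.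
      rewrite (r_sym (z u)), (r_sym (inj _ _ _)), z_form, p_form by auto using in_N_inj.
      rewrite (a_sym St (p v)), Rmult_1_l; reflexivity. }
    split; [|split].
    + intros w Hw; rewrite EE, vadd_vlin; apply in_N_lin; auto using in_N_inj.
    + intros u v Hu Hv; rewrite (a_sym St u), !E_form by auto.
      rewrite (a_sym St (r u)), (a_sym St (p u)), E_sym, (a_sym St (p u)) by (apply Hp; assumption).
      reflexivity.
    + intros w Hw; rewrite E_form by auto.
      (* Pythagoras for the coarse projection; it also identifies the first two terms of [E_form] at
         [u = v = w]. *)
      assert (Ezz : a St (z w) (z w) = a St (r w) (r w) - a St (p w) (p w)).
      { unfold z at 2; rewrite vsub_vlin, (form_lin_r _ _ HS Hb), z_form by auto using in_N_inj.
        rewrite (a_sym St (z w)); unfold z; rewrite vsub_vlin, (form_lin_r _ _ HS Hb), p_form, a_inj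
          by auto using in_N_inj; ring. }
      destruct (E_bd (p w) (Hp w Hw)) as [B0 B1].
      pose proof (a_ge_0 St (S k) (z w) V Ha (Hz w Hw)) as Pz.
      split; [lra|].
      assert (Approx : a St (z w) (z w) <= K * (a St (r w) (r w) - a St (T (r w)) (r w))).
      { destruct (Hdec (S k) (r w) ltac:(lia) (Hr w Hw)) as (wT & wX & HT & HX & Ew & Hsum).
        fold (p w) in Ew, Hsum; fold (z w) in Ew, Hsum.
        rewrite ET.
        apply (stable_decomposition_bound _ _ HS Hb (box + box) l U P eta HUS HP Heta C
          (fun i => match i with inl T => wT T | inr X => wX X end) (z w) (r w) HC (Hz w Hw) (Hr w Hw)).
        - intros [X|X] Hi; unfold l, index in Hi; apply in_app_or in Hi;
            destruct Hi as [Hi|Hi]; apply in_map_iff in Hi as (Y & EY & HY); try congruence;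
            inversion EY; subst; [now apply HT | now apply HX].
        - unfold l, index; rewrite map_app, !map_map, vsum_app.
          extensionality x; extensionality i; apply Ew.
        - unfold l, index; rewrite map_app, !map_map, rsum_app; exact Hsum.
        - rewrite z_form by auto; lra. }
      pose proof (smoothing_property _ _ HS Hb T T_in T_sym T_ge_0 m w Hw) as Sm.
      fold (r w) in Sm.
      (* [D] is the loss in one further smoothing step, the quantity shared by the approximation and
         smoothing estimates; the identity for [gamma] cancels it. *)
      set (D := a St (r w) (r w) - a St (T (r w)) (r w)) in *.
      assert ((1 - gamma) * a St (z w) (z w) <= (1 - gamma) * (K * D))
        by (apply Rmult_le_compat_l; lra).
      assert (gamma * (2 * INR m * D) <= gamma * (a St w w - a St (r w) (r w)))
        by (apply Rmult_le_compat_l; lra).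
      assert ((1 - gamma) * (K * D) = gamma * (2 * INR m * D))
        by (rewrite <- Rmult_assoc, HgK; ring).
      nra.
Qed.

Theorem theorem4p10 (St : setup) (s : smoother) (eta C : R) (m k : nat) (w : vf) :
  valid_setup St -> 0 < alpha St ->
  0 < eta -> eta <= eta_max s ->
  0 < C -> decomposition_constant St s C ->
  (1 <= m)%nat -> (1 <= k)%nat -> in_N St k w ->
  anorm St (Eop St s eta m k w) <= (C / eta) / (C / eta + 2 * INR m) * anorm St w.
Proof.
  intros V Ha Heta Hmax HC Hdec Hm Hk Hw.
  assert (HK : 0 < C / eta) by (apply Rdiv_lt_0_compat; auto).
  assert (Hm' : 1 <= INR m) by (apply (le_INR 1); auto).
  pose proof (Eop_contraction St s eta C m V Ha Heta Hmax HC Hdec Hm k) as H.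
  set (gamma := C / eta / (C / eta + 2 * INR m)) in *.
  assert (Hg : 0 < gamma) by (apply Rdiv_lt_0_compat; lra).
  unfold anorm; rewrite <- (sqrt_square gamma) by lra.
  rewrite <- sqrt_mult by (nra || now apply (a_ge_0 St k)).
  apply sqrt_le_1_alt, (contraction_norm (in_N St k)); auto using subspace_N, psd_a.
Qed.
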